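(* In the fixed-design regression framework described in the context, assume that $\mathcal M$ is finite, contains at least one model of dimension at most $c_n\in[0,n/3)$, that there exists $m_1\in\mathcal M$ with $S_{m_1}=\mathbb R^n$, and that $\varepsilon\sim\mathcal N(0,\sigma^2I_n)$. Let $T_n\in(c_n,n)$, $\eta>0$, and let $\widehat C_{\mathrm{thr.}}(T_n)$ and $\widehat C_{\mathrm{window}}(\eta)$ be defined as in the context. For any $x\ge0$ and $T\in(c_n,n)$ define $$C_1(x;T)=\sigma^2\left(1-\frac{4\sqrt{x/n}+6x/n}{1-T/n}\right),$$ $$C_2(x;T;c_n)=\sigma^2\left[1+\frac{4n}{T-c_n}\left(\sqrt{\frac xn}+\frac{2x}n\right)\right]+\frac{2n}{T-c_n}\mathcal B(c_n),$$ where $\mathcal B(c)=\inf_{m\in\mathcal M,\ D_m\le c}\left\{\frac1n\|(I_n-\Pi_m)F\|^2\right\}$. Then, for every $x\ge 0$, there exists an event $\Omega_x$ of probability at least $1-4\,\mathrm{card}(\mathcal M)e^{-x}$ on which $$\frac{C_1(x;\frac{2n}3)}{1+\eta}\le\widehat C_{\mathrm{window}}(\eta)\le C_2\!\left(x;\frac n3;c_n\right)(1+\eta)\quad\text{if}\quad\eta>\sqrt{\frac{C_2(x;\frac n3;c_n)}{C_1(x;\frac{2n}3)}}-1\ \text{ and }\ x\in\left[0,\frac n{180}\right],$$ and $$C_1(x;T_n)\le\widehat C_{\mathrm{thr.}}(T_n)\le C_2(x;T_n;c_n).$$ If we assume in addition that $c_n\le T_n/2$, then $$\mathbb E\left[\left(\widehat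 C_{\mathrm{thr.}}(T_n)-\sigma^2\right)^2\right]\le739\max\left\{\left(1-\frac{T_n}n\right)^{-2},\left(\frac{T_n}{2n}\right)^{-2}\right\}\left[\mathcal B\!\left(\frac{T_n}2\right)^2+\frac{\sigma^4\log(4\,\mathrm{card}\,\mathcal M)}n+\sigma^4\left(\frac{\log(4\,\mathrm{card}\,\mathcal M)}n\right)^2\right].$$
   Context: Framework: one observes $Y=F+\varepsilon\in\mathbb R^n$, where $F\in\mathbb R^n$ is deterministic and $\varepsilon_1,\dots,\varepsilon_n$ are i.i.d. with mean $0$ and variance $\sigma^2>0$. $\|\cdot\|$ is the Euclidean norm and $I_n$ the identity matrix. $(S_m)_{m\in\mathcal M}$ is a (deterministic) collection of linear subspaces of $\mathbb R^n$, called models. For $m\in\mathcal M$, $\Pi_m$ is the orthogonal projection onto $S_m$, $D_m=\dim(S_m)$, $\widehat F_m=\Pi_mY$. For every $C\ge0$, $$\widehat m(C)\in\operatorname*{argmin}_{m\in\mathcal M}\left\{\frac1n\|\widehat F_m-Y\|^2+C\,\frac{D_m}n\right\}.$$ The estimators of $\sigma^2$ are $$\widehat C_{\mathrm{thr.}}(T_n)=\inf\left\{C\ge0:\ D_{\widehat m(C)}\le T_n\right\},\qquad\widehat C_{\mathrm{window}}(\eta)\in\operatorname*{argmax}_{C>0}\left\{D_{\widehat m(C/[1+\eta])}-D_{\widehat m(C[1+\eta])}\right\}.$$ *)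

(* Defs.v *)
From HB Require Import structures.
From mathcomp Require Import all_boot all_order all_algebra.
From mathcomp Require Import sesquilinear ring.
From mathcomp Require Import all_classical all_reals all_analysis.
Set Implicit Arguments.
Unset Strict Implicit.
Unset Printing Implicit Defensive.
Import Order.TTheory GRing.Theory Num.Theory.
Local Open Scope classical_set_scope.
Local Open Scope ring_scope.

Section Euclidean.
Variables (R : realType) (n : nat).
Implicit Types (u v : 'rV[R]_n) (V : {vspace 'rV[R]_n}).

Definition dotv u v : R := \sum_(i < n) u 0 i * v 0 i.

(* The norm `|u| that MathComp-Analysis puts on 'rV[R]_n is the sup norm. *)
Definition enorm u : R := Num.sqrt (dotv u u).

Let dotv_bilinear :
  bilinear_for ( *%R : R -> R -> R) ( *%R : R -> R -> R) dotv.
Proof.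
split=> w a u v /=; rewrite /dotv mulr_sumr -big_split /=;
  by apply: eq_bigr => i _; rewrite !mxE; ring.
Qed.

HB.instance Definition _ :=
  bilinear_isBilinear.Build R 'rV[R]_n 'rV[R]_n R *%R *%R dotv dotv_bilinear.

Let dotv_hermitian u v : dotv u v = (-1) ^+ false * idfun (dotv v u).
Proof. by rewrite expr0 mul1r; apply: eq_bigr => i _; rewrite mulrC. Qed.

HB.instance Definition _ :=
  isHermitianSesquilinear.Build R 'rV[R]_n false idfun dotv dotv_hermitian.

Let dotv_gt0 u : u != 0 -> 0 < dotv u u.
Proof.
move=> u0; have [i ui0] : exists i, u 0 i != 0.
  apply/existsP; apply: contraNT u0 => /existsPn ui; apply/eqP/rowP => i.
  by rewrite mxE; apply/eqP; have := ui i; rewrite negbK.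
rewrite /dotv (bigD1 i) //= ltr_pwDl //; first by rewrite -expr2 exprn_even_gt0.
by apply: sumr_ge0 => j _; rewrite -expr2 sqr_ge0.
Qed.

HB.instance Definition _ := isDotProduct.Build R 'rV[R]_n dotv dotv_gt0.

Definition orthocompl V : {vspace 'rV[R]_n} :=
  orthov (dotv : {hermitian 'rV[R]_n for false & idfun}) V.

(* Orthogonal projection onto V; [daddv_pi] is meaningful because V and its
   orthogonal complement are in direct sum: see [orthprojP]. *)
Definition orthproj V : 'End('rV[R]_n) := daddv_pi V (orthocompl V).

Lemma cap_orthocompl V : (V :&: orthocompl V = 0)%VS.
Proof.
apply/eqP; rewrite -subv0; apply/subvP => u; rewrite memv_cap => /andP[uV uO].
rewrite memv0; apply: contraT => /dotv_gt0.
by move/mem_orthovP: uO => -> //; rewrite ltxx.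
Qed.

Lemma add_orthocompl V : (V + orthocompl V = fullv)%VS.
Proof.
apply/eqP; rewrite -(dimv_leqif_eq (subvf _)) eqn_leq dimvS ?subvf //=.
rewrite dimv_disjoint_sum ?cap_orthocompl //.
pose g u := \row_(i < \dim V) dotv u (vbasis V)`_i.
have g_lin : linear g.
  by move=> a u v; apply/rowP => i; rewrite !mxE linearPl.
pose gL := GRing.isLinear.Build _ _ _ _ g g_lin.
pose gl : {linear 'rV[R]_n -> 'rV[R]_(\dim V)} := HB.pack g gL.
have ker_sub : (lker (linfun gl) <= orthocompl V)%VS.
  apply/subvP => u; rewrite memv_ker lfunE /= => /eqP gu0.
  apply/mem_orthovP => v /coord_vbasis ->; rewrite linear_sumr big1 // => i _.
  by rewrite linearZr /=; have /rowP/(_ i) := gu0; rewrite !mxE => ->; rewrite mulr0.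
rewrite -(limg_ker_dim (linfun gl) fullv) capfv addnC leq_add ?dimvS //.
by rewrite (leq_trans (dimvS (subvf _))) // dimvf /dim /= mul1n.
Qed.

Lemma orthprojP V u :
  orthproj V u \in V /\ {in V, forall v, dotv (u - orthproj V u) v = 0}.
Proof.
split=> [|v vV]; first exact: memv_pi.
have uVO : (u \in V + orthocompl V)%VS by rewrite add_orthocompl memvf.
rewrite -{1}(daddv_pi_add (cap_orthocompl V) uVO) addrC addKr.
exact: (mem_orthovP (memv_pi (orthocompl V) V u)).
Qed.

End Euclidean.

Definition argmin (R : realType) (X : Type) (D : set X) (f : X -> R) : set X :=
  [set x | D x /\ forall y, D y -> f x <= f y].

Definition argmax (R : realType) (X : Type) (D : set X) (f : X -> R) : set X :=
  [set x | D x /\ forall y, D y -> f y <= f x].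

Section Noise.
Context d (Omega : measurableType d) (R : realType) (P : probability Omega R).

Definition mutually_independent (I : finType) (X : I -> {RV P >-> R}) : Prop :=
  forall (J : {set I}) (B : I -> set R), (forall i, measurable (B i)) ->
    P (\bigcap_(i in [set` J]) (X i @^-1` B i)) =
    (\prod_(i in J) P (X i @^-1` B i))%E.

(* [eps] is a vector of law N(0, sigma^2 I_n). The second parameter of
   [normal_prob] is the standard deviation. *)
Definition gaussian_noise (n : nat) (sigma : R) (eps : 'I_n -> {RV P >-> R}) :
    Prop :=
  mutually_independent eps /\
  forall i (A : set R), measurable A ->
    distribution P (eps i) A = normal_prob 0 sigma A.

Definition observation (n : nat) (F : 'rV[R]_n) (eps : 'I_n -> {RV P >-> R})
    (w : Omega) : 'rV[R]_n :=
  F + \row_i eps i w.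

End Noise.

Section Selection.
Variables (R : realType) (n : nat) (M : finType) (S : M -> {vspace 'rV[R]_n}).

(* D_m, as a real number. *)
Definition model_dim (m : M) : R := (\dim (S m))%:R.

Definition penalized_risk (Y : 'rV[R]_n) (C : R) (m : M) : R :=
  n%:R^-1 * enorm (orthproj (S m) Y - Y) ^+ 2 + C * (model_dim m / n%:R).

(* B(c); used only when some model has dimension at most c, so that the infimum
   is over a nonempty set ([inf set0] is 0). *)
Definition bias (F : 'rV[R]_n) (c : R) : R :=
  inf [set n%:R^-1 * enorm (F - orthproj (S m) F) ^+ 2 |
       m in [set m | model_dim m <= c]].

(* Below, [mh] is a path C |-> mhat(C) of selected models. *)
Definition C_thr (mh : R -> M) (T : R) : R :=
  inf [set C | 0 <= C /\ model_dim (mh C) <= T].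

Definition dim_jump (mh : R -> M) (eta C : R) : R :=
  model_dim (mh (C / (1 + eta))) - model_dim (mh (C * (1 + eta))).

Definition C_window (mh : R -> M) (eta : R) : set R :=
  argmax [set C | 0 < C] (dim_jump mh eta).

Definition C1 (sigma x T : R) : R :=
  sigma ^+ 2 * (1 - (4 * Num.sqrt (x / n%:R) + 6 * x / n%:R) / (1 - T / n%:R)).

Definition C2 (F : 'rV[R]_n) (sigma x T c : R) : R :=
  sigma ^+ 2 *
    (1 + 4 * n%:R / (T - c) * (Num.sqrt (x / n%:R) + 2 * x / n%:R)) +
  2 * n%:R / (T - c) * bias F c.

End Selection.
Arguments C1 {R} n sigma x T.

(* Main.v *)
Require Import Defs.
From HB Require Import structures.
From mathcomp Require Import all_boot all_order all_algebra.
From mathcomp Require Import sesquilinear ring lra.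
From mathcomp Require Import all_classical all_reals all_analysis.
From mathcomp Require Import measurable_realfun measurable_fun_approximation.
Set Implicit Arguments.
Unset Strict Implicit.
Unset Printing Implicit Defensive.
Import Order.TTheory GRing.Theory Num.Theory.
Local Open Scope classical_set_scope.
Local Open Scope ring_scope.

(** Why the theorem holds. Write [v m] for [F - Pi_m F] and [e] for the noise.
    Since [Pi_m] is an orthogonal projection,
      [|Y - Pi_m Y|^2 = |v m|^2 + 2 <v m, e> + |e|^2 - |Pi_m e|^2],
    so the penalized risks of all models are controlled as soon as, for every
    [m], the Gaussian variable [<v m, e>] and the chi-square variable
    [|Pi_m e|^2] are close to their means.

    Concentration. With [r = sqrt (x / n)], four one-sided deviations are
    needed for each model, each failing with probability at most [exp (- x)];
    this is where the factor [4 card M] comes from ([gaussian_good_event]).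
    All of them are Chernoff bounds. The exponential moments are computed by
    [noise_quadratic_mgf], which rests on two facts: independence factorizes the
    expectation of [exp (- s |e|^2 + <v, e>)] over the coordinates, where a
    square is completed; and [exp (lam y^2)] is the average of
    [exp (sqrt (2 lam) y t)] over a standard normal [t], so that Tonelli's
    theorem removes the squares [<u, e>^2], [u] in an orthonormal family, one by
    one. The upper deviations of [|Pi_m e|^2] take an orthonormal basis of [S_m] and
    [s = 0]; the lower deviations write [- |Pi_m e|^2] as
    [- |e|^2 + |Pi' e|^2], [Pi'] being the projection onto the orthogonal
    complement of [S_m].

    Selection. On the good event, if [C < C1 x T], every model of dimension at
    most [T] loses against the full model, so the selected dimension exceeds [T]
    ([dim_gt_of_lt_C1]); if [C > C2 x T c], every model of dimension above [T]
    loses against the model realizing the bias [B(c)], so the selected dimension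
    is at most [T] ([dim_le_of_gt_C2]). The bounds on the threshold estimator
    follow from the definition of the infimum. For the window estimator, the
    condition on [eta] provides a [C] at which the jump exceeds [n / 3], whereas
    outside the claimed interval the jump is at most [n / 3].

    Quadratic risk. Applying the threshold bounds with [c = T / 2] and
    [x = log (4 card M) + k] gives a bound [h k], quadratic in [k], on the
    squared error outside an event of probability at most [exp (- k)]. Summing
    the increments of [h] against these probabilities
    ([integral_le_geometric_tails]) gives the bound in expectation. The
    selected model need not depend measurably on the noise, so the expectation is
    handled as the lower integral that it is by definition. *)

(** * Integration against a density *)

Section Density.
Context d1 d2 (T1 : measurableType d1) (T2 : measurableType d2) (R : realType).
Variables (mu : {measure set T1 -> \bar R}) (nu : {measure set T2 -> \bar R}).
Variables (X : T1 -> T2) (w : T1 -> R) (k : R).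
Hypotheses (mX : measurable_fun setT X) (mw : measurable_fun setT w).
Hypotheses (w0 : forall x, 0 <= w x).
Hypothesis dens : forall A, measurable A ->
  (k%:E * nu A = \int[mu]_(x in X @^-1` A) (w x)%:E)%E.

Import HBNNSimple.

Let nnsfun_density (h : {nnsfun T2 >-> R}) :
  (k%:E * \int[nu]_y (h y)%:E = \int[mu]_x (w x * h (X x))%:E)%E.
Proof.
have mXA A : measurable A -> measurable (X @^-1` A).
  by move=> mA; rewrite -[X in measurable X]setTI; exact: mX.
rewrite integralT_nnsfun sintegralE.
transitivity (\int[mu]_x (\sum_(r \in range h)
    (r * (w x * \1_(X @^-1` (h @^-1` [set r])) x))%:E))%E; last first.
  apply: eq_integral => x _; rewrite fsumEFin//; congr EFin.
  rewrite [in RHS](fimfunE h (X x)) mulr_fsumr//.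
  by apply: eq_fsbigr => r _; rewrite mulrCA.
rewrite ge0_integral_fsum//; last 2 first.
- move=> r; apply/measurable_EFinP; apply: measurable_funM => //.
  by apply: measurable_funM => //; apply: measurable_indic; exact: mXA.
- move=> r x _; have [r0|r0] := leP 0 r.
    by rewrite lee_fin mulr_ge0// mulr_ge0.
  by rewrite (preimage_nnfun0 h r0) preimage_set0 indic0 mulr0 mulr0.
rewrite ge0_mule_fsumr; last first.
  move=> r; have [r0|r0] := leP 0 r; first by rewrite mule_ge0.
  by rewrite (preimage_nnfun0 h r0) measure0 mule0.
apply: eq_fsbigr => r _; rewrite muleCA dens//.
under [RHS]eq_integral do rewrite EFinM.
have [r0|r0] := leP 0 r; last first.
  rewrite (preimage_nnfun0 h r0) preimage_set0 integral_set0 mule0.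
  by rewrite integral0_eq// => x _; rewrite indic0 mulr0 mule0.
rewrite ge0_integralZl//; last 2 first.
- apply/measurable_EFinP; apply: measurable_funM => //.
  by apply: measurable_indic; exact: mXA.
- by move=> x _; rewrite lee_fin mulr_ge0.
congr *%E; rewrite integral_mkcond; apply: eq_integral => x _.
by rewrite epatch_indic EFinM.
Qed.

(** The identity is linear and stable under increasing limits in [f], hence it
    propagates from indicators. The constant [k] allows two uses: [w] a density
    and [X] the identity, or [X] a random variable independent of a weight [w] of
    expectation [k]. *)
Lemma integral_density (f : T2 -> R) :
  measurable_fun setT f -> (forall y, 0 <= f y) ->
  (k%:E * \int[nu]_y (f y)%:E = \int[mu]_x (w x * f (X x))%:E)%E.
Proof.
move=> mf f0.
have mEf : measurable_fun setT (EFin \o f) by exact/measurable_EFinP.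
pose h := nnsfun_approx measurableT mEf.
have cvgh y : (h n y)%:E @[n --> \oo] --> (f y)%:E.
  by apply: (@cvg_nnsfun_approx _ _ _ _ measurableT _ mEf) => // z _; rewrite lee_fin.
transitivity (limn (fun n => k%:E * \int[nu]_y (h n y)%:E))%E.
  rewrite limeMl//; last first.
    apply: ereal_nondecreasing_is_cvgn => a b ab; apply: ge0_le_integral => //.
    - by move=> y _; rewrite lee_fin.
    - by apply/measurable_EFinP.
    - by apply/measurable_EFinP.
    - by move=> y _; rewrite lee_fin; exact/lefP/nd_nnsfun_approx.
  rewrite -monotone_convergence//.
  - by congr *%E; apply: eq_integral => y _; apply/esym/cvg_lim.
  - by move=> n; apply/measurable_EFinP.
  - by move=> n y _; rewrite lee_fin.
  - by move=> y _ m n mn; rewrite lee_fin; exact/lefP/nd_nnsfun_approx.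
under eq_fun do rewrite nnsfun_density.
rewrite -monotone_convergence//; last 3 first.
- move=> n; apply/measurable_EFinP; apply: measurable_funM => //.
  exact: measurableT_comp.
- by move=> n x _; rewrite lee_fin mulr_ge0.
- move=> x _ m n mn; rewrite lee_fin ler_wpM2l//.
  exact/lefP/nd_nnsfun_approx.
apply: eq_integral => x _; apply/cvg_lim => //.
under eq_fun do rewrite EFinM.
by rewrite EFinM; apply: cvgeMl.
Qed.

End Density.

(** * Gaussian integrals and independence *)

Section GaussianIntegral.
Variable R : realType.
Implicit Types (sigma tau v x : R).

(** Completing the square. The quadratic coefficient is parametrized by the
    standard deviation [tau] of the tilted normal law: it is negative when
    [tau < sigma] and positive when [tau > sigma]. *)
Lemma normal_pdf_tilt sigma tau v x : 0 < sigma -> 0 < tau ->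
  normal_pdf 0 sigma x *
    expR (- ((tau ^- 2 - sigma ^- 2) / 2) * x ^+ 2 + v * x) =
  tau / sigma * expR (tau ^+ 2 * v ^+ 2 / 2) *
    normal_pdf (tau ^+ 2 * v) tau x.
Proof.
move=> s0 t0; have [sn tn] : sigma != 0 /\ tau != 0 by rewrite !gt_eqF.
rewrite /normal_pdf (negbTE sn) (negbTE tn) /normal_fun.
have -> : normal_peak sigma = normal_peak tau * (tau / sigma).
  have peakE (u : R) : 0 < u -> normal_peak u = u^-1 * (Num.sqrt (pi *+ 2))^-1.
    move=> u0; rewrite /normal_peak -mulrnAr sqrtrM ?sqr_ge0// sqrtr_sqr.
    by rewrite gtr0_norm// invfM.
  by rewrite !peakE//; field; rewrite tn sn sqrtr_eq0 -ltNge pmulrn_lgt0 ?pi_gt0.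
rewrite -[LHS]mulrA -expRD [RHS]mulrACA -expRD [X in _ = X * _]mulrC.
by congr (_ * expR _); field; rewrite tn sn.
Qed.

Let integral_normal_tilt sigma tau v : 0 < sigma -> 0 < tau ->
  (\int[lebesgue_measure]_x (normal_pdf 0 sigma x *
     expR (- ((tau ^- 2 - sigma ^- 2) / 2) * x ^+ 2 + v * x))%:E =
   (tau / sigma * expR (tau ^+ 2 * v ^+ 2 / 2))%:E)%E.
Proof.
move=> s0 t0; under eq_integral do rewrite normal_pdf_tilt// EFinM.
rewrite ge0_integralZl//.
- by rewrite integral_normal_pdf mule1.
- by apply/measurable_EFinP; exact: measurable_normal_pdf.
- by move=> x _; rewrite lee_fin normal_pdf_ge0.
- by rewrite lee_fin mulr_ge0 ?expR_ge0// divr_ge0// ltW.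
Qed.

Lemma normal_quadratic_mgf sigma tau v : 0 < sigma -> 0 < tau ->
  (\int[normal_prob 0 sigma]_x
     (expR (- ((tau ^- 2 - sigma ^- 2) / 2) * x ^+ 2 + v * x))%:E =
   (tau / sigma * expR (tau ^+ 2 * v ^+ 2 / 2))%:E)%E.
Proof.
move=> s0 t0; rewrite -[LHS]mul1e -integral_normal_tilt//.
rewrite (@integral_density _ _ (measurableTypeR R) (measurableTypeR R) R
  (@lebesgue_measure R) _ idfun (normal_pdf 0 sigma))//.
- exact: measurable_id.
- exact: measurable_normal_pdf.
- by move=> x; exact: normal_pdf_ge0.
- by move=> A mA; rewrite mul1e.
- apply: measurableT_comp => //; apply: measurable_funD; exact: measurable_funM.
Qed.

(** [normal_prob] lives on [measurableTypeR R], whose measurable sets are those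
    of [R] but with another display; the law of [X] is therefore compared with
    it through the density. *)
Lemma expectation_normal_quadratic_mgf d (Omega : measurableType d)
    (P : probability Omega R) (X : {RV P >-> R}) sigma tau v :
  0 < sigma -> 0 < tau ->
  (forall A, measurable A -> distribution P X A = normal_prob 0 sigma A) ->
  (\int[P]_w
     (expR (- ((tau ^- 2 - sigma ^- 2) / 2) * X w ^+ 2 + v * X w))%:E =
   (tau / sigma * expR (tau ^+ 2 * v ^+ 2 / 2))%:E)%E.
Proof.
move=> s0 t0 law; rewrite -integral_normal_tilt//.
set f := fun x : R => expR (- ((tau ^- 2 - sigma ^- 2) / 2) * x ^+ 2 + v * x).
have mf : measurable_fun setT f.
  apply: measurableT_comp => //; apply: measurable_funD; exact: measurable_funM.
have f0 x : 0 <= f x by exact: expR_ge0.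
rewrite -(ge0_integral_distribution X (f := EFin \o f)); last 2 first.
- exact/measurable_EFinP.
- by move=> y; rewrite lee_fin.
rewrite -[LHS]mul1e (@integral_density _ _ (measurableTypeR R) R R
  (@lebesgue_measure R) _ idfun (normal_pdf 0 sigma))//.
- exact: measurable_id.
- exact: measurable_normal_pdf.
- by move=> x; exact: normal_pdf_ge0.
- by move=> A mA; rewrite mul1e; exact: law.
Qed.

End GaussianIntegral.

Section Independence.
Context d (Omega : measurableType d) (R : realType) (P : probability Omega R).
Variables (I : finType) (X : I -> {RV P >-> R}) (f : I -> R -> R) (a : I -> R).
Hypothesis indX : mutually_independent X.
Hypotheses (mf : forall i, measurable_fun setT (f i)).
Hypotheses (f0 : forall i x, 0 <= f i x).
Hypothesis fa : forall i, (\int[P]_w (f i (X i w))%:E = (a i)%:E)%E.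

Let measurable_prodf (r : seq I) :
  measurable_fun setT (fun w => \prod_(i <- r) f i (X i w)).
Proof.
apply: measurable_prod => i _; apply: measurableT_comp => //; exact: mf.
Qed.

Let prodf_ge0 (r : seq I) w : 0 <= \prod_(i <- r) f i (X i w).
Proof. by apply: prodr_ge0 => i _; exact: f0. Qed.

(** The induction trades an event [X j \in A] for a factor [f j (X j)]: the
    formula for all events on the coordinate [j] says that [X j] is independent
    of the remaining product, and [integral_density] integrates [f j]. *)
Let integral_prod_indep_on (r : seq I) (J : {set I}) (B : I -> set R) :
  uniq r -> all (fun i => i \notin J) r -> (forall i, measurable (B i)) ->
  (\int[P]_(w in \bigcap_(i in [set` J]) (X i @^-1` B i))
      (\prod_(i <- r) f i (X i w))%:E =
   (\prod_(i <- r) a i)%:E * \prod_(i in J) P (X i @^-1` B i))%E.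
Proof.
have mXB i (C : set R) : measurable C -> measurable (X i @^-1` C).
  by move=> mC; rewrite -[X in measurable X]setTI; exact: measurable_funP.
elim: r J B => [|j r IH] J B /=.
  move=> _ _ mB; rewrite big_nil mul1e -indX//.
  under eq_integral do rewrite big_nil.
  rewrite integral_cst ?mul1e//.
  by apply: fin_bigcap_measurable => // i _; exact: mXB.
move=> /andP[jr ur] /andP[jJ rJ] mB.
set E := \bigcap_(i in _) _.
have mE : measurable E.
  by apply: fin_bigcap_measurable => // i _; exact: mXB.
set p := (\prod_(i in J) _)%E.
have pE : p = (fine p)%:E by rewrite fineK// /p -indX// fin_num_measure.
rewrite pE big_cons [a j * _]mulrC -EFinM -mulrA [a j * _]mulrC mulrA.
rewrite [RHS]EFinM -fa -(ge0_integral_distribution (X j) (f := EFin \o f j)); last 2 first.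
- exact/measurable_EFinP.
- by move=> y; rewrite lee_fin.
rewrite (@integral_density _ _ _ _ _ P _ (X j)
   (fun w => (\prod_(i <- r) f i (X i w)) * \1_E w))//.
- rewrite [LHS]integral_mkcond; apply: eq_integral => w _.
  by rewrite epatch_indic big_cons -EFinM; congr EFin; rewrite /=; ring.
- by apply: measurable_funM => //; exact: measurable_indic.
- by move=> w; rewrite mulr_ge0.
- move=> A mA.
  pose B' i := if i == j then A else B i.
  have mB' i : measurable (B' i) by rewrite /B'; case: ifP.
  have E'E : \bigcap_(i in [set` j |: J]) (X i @^-1` B' i) = E `&` X j @^-1` A.
    rewrite eqEsubset; split => w /=.
      move=> H; split; last first.
        by have := H j; rewrite /= in_setU1 eqxx /B' eqxx; exact.
      move=> i /= iJ; have := H i; rewrite /= in_setU1 iJ orbT /B'.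
      case: eqP => [ij|_]; last exact.
      by move: jJ; rewrite -ij iJ.
    move=> [Ew Aw] i /=; rewrite in_setU1 /B'.
    by case: eqP => [->//|_ /= iJ]; exact: Ew.
  have := IH (j |: J)%SET B' ur _ mB'; rewrite E'E big_setU1//= {1}/B' eqxx => IH'.
  rewrite EFinM -pE -muleA [(p * _)%E]muleC.
  have -> : p = (\prod_(i in J) P (X i @^-1` B' i))%E.
    apply: eq_bigr => i iJ; rewrite /B'; case: eqP => // ij.
    by move: jJ; rewrite -ij iJ.
  rewrite -IH'.
    rewrite setIC integral_mkcondr; apply: eq_integral => w _.
    by rewrite epatch_indic EFinM.
  apply/allP => i ir; rewrite in_setU1 negb_or (allP rJ i ir) andbT.
  by apply: contraNneq jr => <-.
Qed.

Lemma integral_prod_indep :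
  (\int[P]_w (\prod_i f i (X i w))%:E = (\prod_i a i)%:E)%E.
Proof.
have := @integral_prod_indep_on (index_enum I) finset.set0 (fun _ => setT).
rewrite big_set0 mule1 (_ : \bigcap_(i in _) _ = setT); first
  by apply=> //; [exact: index_enum_uniq|apply/allP => i _; rewrite inE].
by rewrite -subTset => w _ i /=; rewrite inE.
Qed.

End Independence.

(** * Exponential moments of quadratic forms of the noise *)

Section Linearization.
Context d (Omega : measurableType d) (R : realType) (P : probability Omega R).

Lemma expR_sqr_normal (lam y : R) : 0 <= lam ->
  (\int[normal_prob 0 1]_t (expR (Num.sqrt (2 * lam) * y * t))%:E =
   (expR (lam * y ^+ 2))%:E)%E.
Proof.
move=> lam0; have := @normal_quadratic_mgf R 1 1 (Num.sqrt (2 * lam) * y) ltr01 ltr01.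
rewrite subrr mul0r oppr0 divr1 mul1r expr1n mul1r exprMn sqr_sqrtr; last first.
  by rewrite mulr_ge0.
rewrite (_ : 2 * lam * _ / 2 = lam * y ^+ 2); last by field.
by move=> <-; apply: eq_integral => t _; rewrite mul0r add0r.
Qed.

(** Averaging over an auxiliary normal variable turns the square of [Y] into a
    term linear in [Y]. *)
Lemma integral_linearize (G Y : Omega -> R) (lam : R) :
  measurable_fun setT G -> measurable_fun setT Y -> 0 <= lam ->
  (\int[P]_w (expR (G w + lam * Y w ^+ 2))%:E =
   \int[normal_prob 0 1]_t
     \int[P]_w (expR (G w + Num.sqrt (2 * lam) * Y w * t))%:E)%E.
Proof.
move=> mG mY lam0.
rewrite -(@fubini_tonelli _ _ _ _ _ P (normal_prob 0 1)
  (fun z => (expR (G z.1 + Num.sqrt (2 * lam) * Y z.1 * z.2))%:E)); last 2 first.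
- apply/measurable_EFinP; apply: measurableT_comp => //.
  apply: measurable_funD; first by apply: measurableT_comp.
  apply: measurable_funM => //; apply: measurable_funM => //.
  by apply: measurableT_comp.
- by move=> z; rewrite lee_fin expR_ge0.
apply: eq_integral => w _ /=.
under eq_integral do rewrite expRD EFinM.
rewrite ge0_integralZl//.
- by rewrite expR_sqr_normal// -EFinM -expRD.
- by apply/measurable_EFinP; apply: measurableT_comp => //; exact: measurable_funM.
Qed.

End Linearization.

Section Orthonormal.
Variables (R : realType) (n : nat).
Implicit Types (u v : 'rV[R]_n) (V : {vspace 'rV[R]_n}) (l : seq 'rV[R]_n).

Definition orthonormal l :=
  pairwise (fun u v => dotv u v == 0) l && all (fun u => dotv u u == 1) l.

Lemma dotvC u v : dotv u v = dotv v u.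
Proof. by apply: eq_bigr => i _; rewrite mulrC. Qed.

Lemma dotvDl u v w : dotv (u + v) w = dotv u w + dotv v w.
Proof. by rewrite linearDl. Qed.

Lemma dotvZl a u w : dotv (a *: u) w = a * dotv u w.
Proof. by rewrite linearZl_LR. Qed.

Lemma dotvBl u v w : dotv (u - v) w = dotv u w - dotv v w.
Proof. by rewrite linearBl. Qed.

Lemma dotv0l u : dotv 0 u = 0.
Proof. by rewrite linear0l. Qed.

Lemma dotvNl u v : dotv (- u) v = - dotv u v.
Proof. by rewrite linearNl. Qed.

Lemma dotvv_ge0 u : 0 <= dotv u u.
Proof. by apply: sumr_ge0 => i _; rewrite -expr2 sqr_ge0. Qed.

Lemma dotvv_eq0 u : (dotv u u == 0) = (u == 0).
Proof.
apply/eqP/eqP => [/eqP|->]; last exact: dotv0l.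
rewrite psumr_eq0 => [/allP u0|i _]; last by rewrite -expr2 sqr_ge0.
by apply/rowP => i; have := u0 i (mem_index_enum i); rewrite mxE -expr2 sqrf_eq0 => /eqP.
Qed.

Lemma enorm_sqr u : enorm u ^+ 2 = dotv u u.
Proof. by rewrite sqr_sqrtr// dotvv_ge0. Qed.

Lemma dotvv_sqrD u v : dotv (u + v) (u + v) = dotv u u + 2 * dotv u v + dotv v v.
Proof.
by rewrite dotvDl [dotv u _]dotvC [dotv v _]dotvC !dotvDl (dotvC v u); ring.
Qed.

End Orthonormal.

Section GaussianVector.
Context d (Omega : measurableType d) (R : realType) (P : probability Omega R).
Variables (n : nat) (sigma : R) (eps : 'I_n -> {RV P >-> R}).
Hypotheses (sigma0 : 0 < sigma) (gauss : gaussian_noise sigma eps).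

Definition noise (w : Omega) : 'rV[R]_n := \row_i eps i w.

Lemma measurable_noise i : measurable_fun setT (fun w => noise w 0 i).
Proof.
rewrite (_ : (fun w => _) = eps i); first exact: measurable_funPT.
by apply/funext => w; rewrite mxE.
Qed.

Lemma measurable_dot_noise (u : 'rV[R]_n) :
  measurable_fun setT (fun w => dotv u (noise w)).
Proof.
apply: measurable_sum => i; apply: measurable_funM => //.
exact: measurable_noise.
Qed.

Lemma measurable_sqr_noise :
  measurable_fun setT (fun w => dotv (noise w) (noise w)).
Proof.
by apply: measurable_sum => i; apply: measurable_funM; exact: measurable_noise.
Qed.

(** The exponent is a sum of functions of single coordinates. *)
Lemma noise_mgf (tau : R) (v : 'rV[R]_n) : 0 < tau ->
  (\int[P]_w (expR (- ((tau ^- 2 - sigma ^- 2) / 2) * dotv (noise w) (noise w) +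
                    dotv v (noise w)))%:E =
   ((tau / sigma) ^+ n * expR (tau ^+ 2 / 2 * dotv v v))%:E)%E.
Proof.
move=> tau0; have [ind law] := gauss.
set s := - ((_ - _) / 2).
pose f (i : 'I_n) (x : R) := expR (s * x ^+ 2 + v 0 i * x).
have mf i : measurable_fun setT (f i).
  by apply: measurableT_comp => //; apply: measurable_funD; exact: measurable_funM.
transitivity (\int[P]_w (\prod_i f i (eps i w))%:E)%E.
  apply: eq_integral => w _; congr EFin; rewrite -expR_sum; congr expR.
  rewrite big_split/= mulr_sumr; congr (_ + _); apply: eq_bigr => i _;
  by rewrite !mxE// expr2.
rewrite (integral_prod_indep ind mf
  (a := fun i => tau / sigma * expR (tau ^+ 2 * v 0 i ^+ 2 / 2))).
- rewrite big_split/= prodr_const card_ord -expR_sum; congr ((_ * expR _)%:E).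
  by rewrite mulr_sumr; apply: eq_bigr => i _; rewrite -expr2; ring.
- by move=> i x; exact: expR_ge0.
- by move=> i; rewrite -(expectation_normal_quadratic_mgf _ sigma0 tau0 (law i)).
Qed.

(** Linearizing the square of [<e, noise>] replaces [v] by
    [v + (sqrt (2 lam) t) e], which is still orthogonal to the rest of the
    family and whose squared norm is [|v|^2 + 2 lam t^2]; the remaining integral over
    [t] is one-dimensional. *)
Lemma noise_quadratic_mgf (tau lam : R) (l : seq 'rV[R]_n) (v : 'rV[R]_n) :
  0 < tau -> 0 <= lam -> 2 * lam * tau ^+ 2 < 1 ->
  orthonormal l -> all (fun u => dotv v u == 0) l ->
  (\int[P]_w (expR (- ((tau ^- 2 - sigma ^- 2) / 2) * dotv (noise w) (noise w) +
                    lam * (\sum_(e <- l) dotv e (noise w) ^+ 2) +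
                    dotv v (noise w)))%:E =
   ((tau / sigma) ^+ n * (Num.sqrt (1 - 2 * lam * tau ^+ 2))^-1 ^+ size l *
    expR (tau ^+ 2 / 2 * dotv v v))%:E)%E.
Proof.
move=> tau0 lam0 lamtau; set s := - ((_ - _) / 2).
elim: l v => [|e l IH] v.
  move=> _ _; rewrite expr0 mulr1 -noise_mgf//.
  by apply: eq_integral => w _; rewrite big_nil mulr0 addr0.
rewrite /orthonormal/= => /andP[/andP[el pl] /andP[e1 l1]] /andP[ve vl].
pose G w := s * dotv (noise w) (noise w) +
    lam * (\sum_(e <- l) dotv e (noise w) ^+ 2) + dotv v (noise w).
have mG : measurable_fun setT G.
  apply: measurable_funD; last exact: measurable_dot_noise.
  apply: measurable_funD; apply: measurable_funM => //.
    exact: measurable_sqr_noise.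
  apply: measurable_sum => u; apply: measurable_funX.
  exact: measurable_dot_noise.
transitivity (\int[P]_w (expR (G w + lam * dotv e (noise w) ^+ 2))%:E)%E.
  apply: eq_integral => w _; congr ((expR _)%:E).
  by rewrite /G big_cons; ring.
rewrite integral_linearize//; last exact: measurable_dot_noise.
pose K := (tau / sigma) ^+ n * (Num.sqrt (1 - 2 * lam * tau ^+ 2))^-1 ^+ size l.
transitivity (\int[normal_prob 0 1]_t
    ((K * expR (tau ^+ 2 / 2 * dotv v v))%:E *
     (expR (lam * tau ^+ 2 * t ^+ 2))%:E))%E.
  apply: eq_integral => t _.
  have vel : all (fun u => dotv (v + (Num.sqrt (2 * lam) * t) *: e) u == 0) l.
    apply/allP => u ul; rewrite dotvDl dotvZl (eqP (allP vl u ul)).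
    by rewrite (eqP (allP el u ul)) mulr0 addr0.
  have ol : orthonormal l by rewrite /orthonormal pl l1.
  transitivity (\int[P]_w (expR (s * dotv (noise w) (noise w) +
    lam * (\sum_(e <- l) dotv e (noise w) ^+ 2) +
    dotv (v + (Num.sqrt (2 * lam) * t) *: e) (noise w)))%:E)%E.
    apply: eq_integral => w _; congr ((expR _)%:E).
    by rewrite /G dotvDl dotvZl; ring.
  rewrite IH// -EFinM -/K; congr EFin.
  rewrite -[RHS]mulrA -expRD; congr (K * expR _).
  rewrite dotvv_sqrD [dotv v (_ *: _)]dotvC !dotvZl [dotv e (_ *: _)]dotvC dotvZl.
  rewrite (eqP e1) [dotv e v]dotvC (eqP ve) !mulr0 mulr1 addr0 mulrDr.
  congr (_ + _); set a := Num.sqrt _.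
  transitivity (tau ^+ 2 / 2 * (a ^+ 2 * t ^+ 2)); first by ring.
  by rewrite /a sqr_sqrtr ?mulr_ge0//; field.
rewrite ge0_integralZl//; last 2 first.
- apply/measurable_EFinP; apply: measurableT_comp => //.
  by apply: measurable_funM => //.
- by rewrite lee_fin !mulr_ge0 ?expR_ge0 ?exprn_ge0 ?divr_ge0 ?invr_ge0 ?sqrtr_ge0 ?ltW.
set q := Num.sqrt (1 - 2 * lam * tau ^+ 2).
have q0 : 0 < q by rewrite sqrtr_gt0 subr_gt0.
have q2 : q^-1 ^- 2 = 1 - 2 * lam * tau ^+ 2.
  by rewrite exprVn invrK sqr_sqrtr// subr_ge0 ltW.
have -> : (\int[normal_prob 0 1]_t (expR (lam * tau ^+ 2 * t ^+ 2))%:E =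
    q^-1%:E)%E.
  have := @normal_quadratic_mgf R 1 q^-1 0 ltr01; rewrite invr_gt0 q0 q2 => /(_ isT).
  rewrite expr0n/= mulr0 mul0r expR0 mulr1 divr1 => <-.
  apply: eq_integral => t _; congr ((expR _)%:E).
  by rewrite expr1n invr1; field.
rewrite -EFinM [_ ^+ (size l).+1]exprS /K -/q; congr EFin.
move: (_ ^+ n) (_ ^+ size l) (expR _) => x y z; rewrite -!mulrA; congr (x * _).
by rewrite mulrA mulrC.
Qed.

End GaussianVector.

(** * Exponential inequalities *)

Section ExponentialInequalities.
Variable R : realType.
Implicit Types (f g : R -> R) (x y r : R).

Lemma derive_ge0_le f g x : (forall y, is_derive y 1 f (g y)) ->
  (forall y, 0 <= y -> 0 <= g y) -> 0 <= x -> f 0 <= f x.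
Proof.
move=> df g0; rewrite le_eqVlt => /predU1P[<-//|x0].
have [|c /[!in_itv]/= /andP[c0 _]] := @MVT R f g 0 x x0 (fun y _ => df y).
  by apply: derivable_within_continuous => y _; exact: ex_derive.
by rewrite subr0 -subr_ge0 => ->; rewrite mulr_ge0 ?g0 ?ltW.
Qed.

(** This is [x <= sinh x]; for [1 + 2 r = exp x] it becomes the sharp bound on
    the logarithm required by the upper tail. *)
Lemma expR_sinh_ge x : 0 <= x -> 2 * x <= expR x - expR (- x).
Proof.
move=> x0; rewrite -subr_ge0.
pose f y := expR y - expR (- y) - 2 * y.
have df y : is_derive y 1 f (expR y + expR (- y) - 2).
  apply: is_derive_eq; rewrite /GRing.scale/=. ring.
have -> : expR x - expR (- x) - 2 * x = f x by [].
have -> : 0 = f 0 by rewrite /f oppr0 subrr mulr0 subr0.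
apply: derive_ge0_le df _ x0 => y _.
by have := expR_ge1Dx y; have := expR_ge1Dx (- y); lra.
Qed.

(** The derivative of [exp (y^2 / 2 - y) (1 + y)] is [exp (y^2 / 2 - y) y^2]. *)
Lemma expR_quadratic_le x : 0 <= x -> expR (x - x ^+ 2 / 2) <= 1 + x.
Proof.
move=> x0; pose f y := expR (y ^+ 2 / 2 - y) * (1 + y).
have df y : is_derive y 1 f (expR (y ^+ 2 / 2 - y) * y ^+ 2).
  apply: is_derive_eq; by rewrite /GRing.scale/=; field.
have : f 0 <= f x.
  by apply: derive_ge0_le df _ x0 => y _; rewrite mulr_ge0 ?sqr_ge0.
rewrite {1}/f expr0n/= mul0r subr0 expR0 mul1r addr0 /f.
rewrite -[leRHS](mulrC (1 + x)) -ler_pdivrMr ?expR_gt0// -opprB.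
by rewrite div1r -expRN opprK.
Qed.

Lemma sqrt_expR_le r : 0 <= r ->
  Num.sqrt (1 + 2 * r) <= expR (r * (1 + r) / (1 + 2 * r)).
Proof.
move=> r0; have u0 : 0 < 1 + 2 * r by lra.
have [y uE] := expR_total u0.
have y0 : 0 <= y by rewrite -ler_expR expR0 uE; lra.
have -> : r * (1 + r) / (1 + 2 * r) = (expR y - expR (- y)) / 4.
  by rewrite expRN uE; field; rewrite gt_eqF.
rewrite -uE -(ler_pXn2r (n := 2)) ?nnegrE ?sqrtr_ge0 ?expR_ge0//.
rewrite sqr_sqrtr ?expR_ge0// -expRM_natr ler_expR.
by have := expR_sinh_ge y0; lra.
Qed.

Lemma sqrtV_expR_le r : 0 <= r ->
  (Num.sqrt (1 + 2 * r))^-1 <= expR (r ^+ 2 - r).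
Proof.
move=> r0; have u0 : 0 < 1 + 2 * r by lra.
rewrite -[r ^+ 2 - r]opprB expRN lef_pV2 ?posrE ?expR_gt0 ?sqrtr_gt0//.
rewrite -(ler_pXn2r (n := 2)) ?nnegrE ?sqrtr_ge0 ?expR_ge0//.
rewrite sqr_sqrtr -?expRM_natr; last exact: ltW.
have r2 : 0 <= 2 * r by lra.
apply: le_trans (expR_quadratic_le r2).
by rewrite ler_expR; lra.
Qed.

End ExponentialInequalities.

(** * Orthonormal bases and orthogonal projections *)

Section OrthonormalBasis.
Variables (R : realType) (n : nat).
Implicit Types (u v w : 'rV[R]_n) (V : {vspace 'rV[R]_n}) (l : seq 'rV[R]_n).

Lemma dotv_span0 l u v :
  all (fun e => dotv u e == 0) l -> v \in (span l) -> dotv u v = 0.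
Proof.
move=> /allP ul vl; rewrite (coord_span (X := in_tuple l) vl) linear_sumr big1//.
move=> i _; rewrite linearZr/= (eqP (ul _ _)) ?mulr0//.
by rewrite mem_nth.
Qed.

Lemma orthprojU V u v :
  v \in V -> {in V, forall w, dotv (u - v) w = 0} -> orthproj V u = v.
Proof.
move=> vV uv; have [pV up] := orthprojP V u.
apply/eqP; rewrite -subr_eq0 -dotvv_eq0.
have dV : orthproj V u - v \in V by rewrite memvB.
rewrite {1}(_ : orthproj V u - v = (u - v) - (u - orthproj V u)); last first.
  by rewrite opprB [RHS]addrC addrA subrK.
by rewrite dotvBl uv// up// subrr.
Qed.

Lemma orthonormal_sum l (c : 'rV[R]_n -> R) e : orthonormal l -> e \in l ->
  \sum_(u <- l) c u * dotv u e = c e.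
Proof.
elim: l => // a l IH; rewrite /orthonormal/= => /andP[/andP[al pl] /andP[a1 l1]].
rewrite in_cons big_cons => /predU1P[->|el].
  rewrite (eqP a1) mulr1 big1_seq ?addr0// => u /andP[_ ul].
  by rewrite dotvC (eqP (allP al _ ul)) mulr0.
by rewrite (eqP (allP al _ el)) mulr0 add0r IH// /orthonormal pl l1.
Qed.

(** One step of the Gram-Schmidt process. Freeness is carried along because it
    turns the size of the family into the dimension of its span. *)
Lemma orthonormal_extend V k : (k <= \dim V)%N ->
  exists l, [/\ orthonormal l, size l = k, free l & {subset l <= V}].
Proof.
elim: k => [_|k IH kV].
  by exists [::]; split => //; rewrite nil_free.
have [l [ol sl fl lV]] := IH (ltnW kV).
have [v vV vl] : exists2 v, v \in V & v \notin (span l).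
  apply/subvPn; apply: contraL kV => /dimvS Vl; rewrite -leqNgt -sl.
  exact: leq_trans Vl (dim_span l).
have [pl pv] := orthprojP (span l) v; set w := v - orthproj (span l) v.
have wl : w \notin (span l).
  by apply: contra vl => wl; rewrite -(subrK (orthproj (span l) v) v) memvD.
have w0 : 0 < dotv w w.
  rewrite lt_def dotvv_ge0 dotvv_eq0 andbT; apply: contraNneq wl => ->.
  exact: mem0v.
have a0 : (Num.sqrt (dotv w w))^-1 != 0 by rewrite invr_eq0 gt_eqF// sqrtr_gt0.
exists ((Num.sqrt (dotv w w))^-1 *: w :: l); split.
- move: ol; rewrite /orthonormal/= => /andP[-> ->]; rewrite !andbT.
  apply/andP; split.
    apply/allP => e el; rewrite dotvZl (pv e) ?mulr0//.
    exact: memv_span.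
  rewrite dotvZl dotvC dotvZl mulrA -invfM -expr2 sqr_sqrtr ?dotvv_ge0//.
  by rewrite mulVf// gt_eqF.
- by rewrite /= sl.
- rewrite free_cons fl andbT; apply: contra wl => awl.
  by rewrite -(scalerK a0 w) memvZ.
- move=> u; rewrite in_cons => /predU1P[->|/lV//].
  apply/memvZ/memvB => //.
  by move/span_subvP: lV => /subvP; exact.
Qed.

Lemma orthonormal_basis V : exists l, [/\ orthonormal l, size l = \dim V &
  forall u, dotv (orthproj V u) (orthproj V u) = \sum_(e <- l) dotv e u ^+ 2].
Proof.
have [l [ol sl fl lV]] := orthonormal_extend (leqnn (\dim V)).
exists l; split=> // u.
have spanl : (span l) = V.
  apply/eqP; rewrite eqEdim; apply/andP; split; first exact/span_subvP.
  by rewrite (eqP fl) sl.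
pose p := \sum_(e <- l) dotv e u *: e.
have pV : p \in V by rewrite /p big_seq memv_suml// => e el; rewrite memvZ ?lV.
have up : {in V, forall v, dotv (u - p) v = 0}.
  move=> v; rewrite -spanl; apply: dotv_span0; apply/allP => e el.
  rewrite dotvBl /p linear_sumlz subr_eq0 dotvC; apply/eqP.
  rewrite -[LHS](orthonormal_sum (fun e => dotv e u) ol el).
  by apply: eq_bigr => e' _; rewrite /= dotvZl.
rewrite (orthprojU pV up); have := up _ pV; rewrite dotvBl => /eqP.
rewrite subr_eq0 => /eqP <-; rewrite dotvC /p linear_sumlz.
by apply: eq_bigr => e _; rewrite /= dotvZl expr2.
Qed.

Lemma dim_orthocompl V : (\dim V + \dim (orthocompl V))%N = n.
Proof.
rewrite -dimv_disjoint_sum ?cap_orthocompl// add_orthocompl dimvf.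
by rewrite /dim/= mul1n.
Qed.

Lemma dotv_orthproj V u :
  dotv (orthproj V u) (orthproj V u) = dotv (orthproj V u) u.
Proof.
have [pV up] := orthprojP V u; have := up _ pV; rewrite dotvBl => /eqP.
by rewrite subr_eq0 => /eqP <-; rewrite dotvC.
Qed.

Lemma sqr_dist_orthproj V u :
  dotv (u - orthproj V u) (u - orthproj V u) =
  dotv u u - dotv (orthproj V u) (orthproj V u).
Proof.
rewrite dotvBl [dotv u _]dotvC [dotv (orthproj V u) _]dotvC !dotvBl.
rewrite [dotv u (orthproj _ _)]dotvC -dotv_orthproj; ring.
Qed.

Lemma sqr_orthproj_orthocompl V u :
  dotv (orthproj (orthocompl V) u) (orthproj (orthocompl V) u) =
  dotv u u - dotv (orthproj V u) (orthproj V u).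
Proof.
have [pV up] := orthprojP V u; rewrite -sqr_dist_orthproj.
rewrite (@orthprojU (orthocompl V) u (u - orthproj V u))//.
  by apply/mem_orthovP => w wV; exact: up.
move=> w /mem_orthovP wV; rewrite opprB addrC subrK.
by rewrite dotvC; exact: wV.
Qed.

End OrthonormalBasis.

(** * Concentration of the noise *)

Section Chernoff.
Context d (Omega : measurableType d) (R : realType) (P : probability Omega R).

(** Markov's inequality for [exp G]. *)
Lemma chernoff_event (G : Omega -> R) (x : R) : measurable_fun setT G ->
  (\int[P]_w (expR (G w))%:E <= 1)%E ->
  measurable [set w | x < G w] /\ (P [set w | (x < G w)%R] <= (expR (- x))%:E)%E.
Proof.
move=> mG G1; have mB : measurable [set w | x < G w].
  rewrite (_ : [set w | _] = G @^-1` `]x, +oo[%classic).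
    by rewrite -[X in measurable X]setTI; exact: mG.
  by apply/seteqP; split=> w /=; rewrite in_itv/= andbT.
split=> //; rewrite -(@lee_pmul2l _ (expR x)%:E) ?lte_fin ?expR_gt0//.
rewrite -EFinM -expRD subrr expR0 (le_trans _ G1)//.
rewrite -integral_cst// integral_mkcond; apply: ge0_le_integral => //.
- by move=> w _; rewrite patchE; case: ifP => // _; rewrite lee_fin expR_ge0.
- apply/measurable_restrict => //=.
- by apply/measurable_EFinP; apply: measurableT_comp.
- move=> w _; rewrite patchE; case: ifPn => [/[!inE]/= xG|_].
    by rewrite lee_fin ler_expR ltW.
  by rewrite lee_fin expR_ge0.
Qed.

Lemma chernoff_union (I : finType) (G : I -> Omega -> R) (x : R) :
  (forall i, measurable_fun setT (G i)) ->
  (forall i, (\int[P]_w (expR (G i w))%:E <= 1)%E) ->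
  exists A : set Omega, [/\ measurable A,
    ((1 - #|I|%:R * expR (- x))%R%:E <= P A)%E &
    forall w, A w -> forall i, G i w <= x].
Proof.
move=> mG G1; pose B i := [set w | x < G i w].
have mB i : measurable (B i) by have [] := chernoff_event x (mG i) (G1 i).
pose U := \big[setU/set0]_(i : I) B i.
have mU : measurable U by exact: bigsetU_measurable.
exists (~` U); split; first exact: measurableC.
  rewrite probability_setC// EFinB leeB//.
  apply: (@le_trans _ _ (\sum_(i : I) P (B i))%E).
    rewrite /U; elim: (index_enum I) => [|i r IH].
      by rewrite !big_nil measure0.
    rewrite !big_cons; apply: le_trans (leeD2l _ IH).
    by apply: measureU2 => //; exact: bigsetU_measurable.
  apply: (@le_trans _ _ (\sum_(i : I) (expR (- x))%:E)%E).
    by apply: lee_sum => i _; have [] := chernoff_event x (mG i) (G1 i).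
  by rewrite sumEFin sumr_const mulr_natl.
move=> w nU i; rewrite leNgt; apply/negP => xG; apply: nU.
by rewrite /U -bigcup_seq; exists i => //=; exact: mem_index_enum.
Qed.

End Chernoff.

Section GoodEvent.
Context d (Omega : measurableType d) (R : realType) (P : probability Omega R).
Variables (n : nat) (sigma : R) (eps : 'I_n -> {RV P >-> R}).
Hypotheses (sigma0 : 0 < sigma) (gauss : gaussian_noise sigma eps).
Implicit Types (V : {vspace 'rV[R]_n}) (lam x r : R).

Local Notation e := (noise eps).
Local Notation sqr_proj V w := (dotv (orthproj V (e w)) (orthproj V (e w))).

Lemma linear_mgf (v : 'rV[R]_n) :
  (\int[P]_w (expR (dotv v (e w)))%:E = (expR (sigma ^+ 2 / 2 * dotv v v))%:E)%E.
Proof.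
have := noise_mgf sigma0 gauss v sigma0; rewrite divff ?gt_eqF// expr1n mul1r => <-.
by apply: eq_integral => w _; rewrite subrr mul0r oppr0 mul0r add0r.
Qed.

(** [tau = sigma] in [noise_quadratic_mgf], for an orthonormal basis of [V]. *)
Lemma chi2_mgf V lam : 0 <= lam -> 2 * lam < 1 ->
  (\int[P]_w (expR (lam / sigma ^+ 2 * sqr_proj V w))%:E =
   ((Num.sqrt (1 - 2 * lam))^-1 ^+ \dim V)%:E)%E.
Proof.
move=> lam0 lam1; have [l [ol <- pl]] := orthonormal_basis V.
have s2 : sigma ^+ 2 != 0 by rewrite expf_neq0// gt_eqF.
have lE : 2 * (lam / sigma ^+ 2) * sigma ^+ 2 = 2 * lam.
  by rewrite -mulrA divfK.
have := noise_quadratic_mgf sigma0 gauss (v := 0) (l := l) (lam := lam / sigma ^+ 2) sigma0.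
rewrite lE dotv0l mulr0 expR0 mulr1 divff ?gt_eqF// expr1n mul1r => <-//.
- apply: eq_integral => w _; rewrite pl.
  by rewrite subrr mul0r oppr0 mul0r add0r dotv0l addr0.
- by rewrite divr_ge0 ?sqr_ge0.
- by apply/allP => u _; rewrite dotv0l.
Qed.

(** The squared norm of the projection onto [V] is that of the noise minus that
    of its projection onto the orthogonal complement. The latter has an
    orthonormal basis to which [noise_quadratic_mgf] applies, the term
    [- |noise|^2] being absorbed in [tau]. *)
Lemma chi2_mgfN V lam : 0 <= lam ->
  (\int[P]_w (expR (- (lam / sigma ^+ 2 * sqr_proj V w)))%:E =
   ((Num.sqrt (1 + 2 * lam))^-1 ^+ \dim V)%:E)%E.
Proof.
move=> lam0; have [l [ol sl pl]] := orthonormal_basis (orthocompl V).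
have s2 : sigma ^+ 2 != 0 by rewrite expf_neq0// gt_eqF.
have q2 : 0 < 1 + 2 * lam by lra.
set q := Num.sqrt (1 + 2 * lam); have q0 : 0 < q by rewrite sqrtr_gt0.
have qE : q ^+ 2 = 1 + 2 * lam by rewrite sqr_sqrtr// ltW.
have tau0 : 0 < sigma / q by rewrite divr_gt0.
have tE : (sigma / q) ^+ 2 = sigma ^+ 2 / (1 + 2 * lam) by rewrite expr_div_n qE.
have lE : 2 * (lam / sigma ^+ 2) * (sigma / q) ^+ 2 = 1 - (1 + 2 * lam)^-1.
  by rewrite tE; field; rewrite !gt_eqF.
have vE : (sigma / q) ^- 2 - sigma ^- 2 = 2 * lam / sigma ^+ 2.
  by rewrite tE; field; rewrite !gt_eqF.
have := noise_quadratic_mgf sigma0 gauss (v := 0) (l := l) (lam := lam / sigma ^+ 2) tau0.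
rewrite lE dotv0l mulr0 expR0 mulr1 vE sl.
have -> : (sigma / q / sigma) ^+ n *
    (Num.sqrt (1 - (1 - (1 + 2 * lam)^-1)))^-1 ^+ \dim (orthocompl V) =
    q^-1 ^+ \dim V.
  rewrite (_ : sigma / q / sigma = q^-1); last by field; rewrite !gt_eqF.
  rewrite opprB addrC subrK sqrtrV ?ltW// invrK -/q.
  rewrite -{1}(dim_orthocompl V) exprD -mulrA -exprMn mulVf ?gt_eqF//.
  by rewrite expr1n mulr1.
move=> <-//.
- apply: eq_integral => w _; rewrite -pl sqr_orthproj_orthocompl dotv0l addr0.
  by congr ((expR _)%:E); field; rewrite gt_eqF.
- by rewrite divr_ge0 ?sqr_ge0.
- by rewrite ltrBlDr ltrDl invr_gt0.
- by apply/allP => u _; rewrite dotv0l.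
Qed.

Lemma measurable_sqr_proj V : measurable_fun setT (fun w => sqr_proj V w).
Proof.
have [l [_ _ pl]] := orthonormal_basis V.
under [X in measurable_fun _ X]eq_fun do rewrite pl.
apply: measurable_sum => u; apply: measurable_funX; exact: measurable_dot_noise.
Qed.

Let integral_expR_shift (G : Omega -> R) (c k : R) : measurable_fun setT G ->
  (\int[P]_w (expR (G w))%:E = k%:E ->
   \int[P]_w (expR (G w + c))%:E = (k * expR c)%:E)%E.
Proof.
move=> mG Gk; under eq_integral do rewrite expRD EFinM.
rewrite ge0_integralZr//.
- by rewrite Gk EFinM.
- by apply/measurable_EFinP; apply: measurableT_comp.
Qed.

Let dim_le V : (\dim V)%:R <= n%:R :> R.
Proof.
rewrite ler_nat; exact: leq_trans (leq_addr _ _) (eq_leq (dim_orthocompl V)).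
Qed.

(** Chernoff bound for [|Pi e|^2 / sigma^2 > dim V + 2 n r + 4 n r^2], where
    [n r^2] is the exponent [x]. The parameter [r / (1 + 2 r)] is that of Laurent
    and Massart for dimension [n] and threshold [n + 2 n r + 2 n r^2]. *)
Lemma chi2_upper V r : 0 <= r ->
  (\int[P]_w (expR (r / (1 + 2 * r) / sigma ^+ 2 * sqr_proj V w +
     (n%:R * r ^+ 2 - r / (1 + 2 * r) *
        ((\dim V)%:R + 2 * n%:R * r + 4 * n%:R * r ^+ 2))))%:E <= 1)%E.
Proof.
move=> r0; have u0 : 0 < 1 + 2 * r by lra.
rewrite (integral_expR_shift _ _ (chi2_mgf V _ _)); last 3 first.
- by apply: measurable_funM => //; exact: measurable_sqr_proj.
- by rewrite divr_ge0// ltW.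
- by rewrite mulrA ltr_pdivrMr//; lra.
have -> : 1 - 2 * (r / (1 + 2 * r)) = (1 + 2 * r)^-1 by field; rewrite gt_eqF.
rewrite sqrtrV; last exact: ltW.
rewrite invrK lee_fin.
apply: (@le_trans _ _ (expR (r * (1 + r) / (1 + 2 * r)) ^+ \dim V * _)).
  apply: ler_wpM2r; first exact: expR_ge0.
  by rewrite lerXn2r ?nnegrE ?expR_ge0 ?sqrtr_ge0 ?sqrt_expR_le.
rewrite -expRM_natr -expRD expR_le1.
rewrite (_ : _ + _ = - (r ^+ 2 * (n%:R - (\dim V)%:R) + 2 * n%:R * r ^+ 3) / (1 + 2 * r)).
  rewrite mulNr oppr_le0; apply: divr_ge0; last exact: ltW.
  by rewrite addr_ge0 ?mulr_ge0 ?exprn_ge0 ?subr_ge0.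
by field; rewrite gt_eqF.
Qed.

(** Chernoff bound for [|Pi e|^2 / sigma^2 < dim V - 2 n r], with parameter
    [r]. *)
Lemma chi2_lower V r : 0 <= r ->
  (\int[P]_w (expR (- (r / sigma ^+ 2 * sqr_proj V w) +
     (r * ((\dim V)%:R - 2 * n%:R * r) + n%:R * r ^+ 2)))%:E <= 1)%E.
Proof.
move=> r0; rewrite (integral_expR_shift _ _ (chi2_mgfN V r0)); last first.
  apply: measurableT_comp => //; apply: measurable_funM => //.
  exact: measurable_sqr_proj.
rewrite lee_fin; apply: (@le_trans _ _ (expR (r ^+ 2 - r) ^+ \dim V * _)).
  apply: ler_wpM2r; first exact: expR_ge0.
  by rewrite lerXn2r ?nnegrE ?expR_ge0 ?invr_ge0 ?sqrtr_ge0 ?sqrtV_expR_le.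
rewrite -expRM_natr -expRD expR_le1.
rewrite (_ : _ + _ = - (r ^+ 2 * (n%:R - (\dim V)%:R))).
  by rewrite oppr_le0 mulr_ge0 ?exprn_ge0// subr_ge0.
by ring.
Qed.

(** Chernoff bound for [2 <v, e> > |v|^2 + 2 x sigma^2]. The risk of a
    model contains [|v|^2 + 2 <v, e>], so this is the form in which the deviation
    enters the comparison of the models. *)
Lemma linear_upper (v : 'rV[R]_n) :
  (\int[P]_w (expR (dotv (sigma ^- 2 *: v) (e w) +
     - (dotv v v / (2 * sigma ^+ 2))))%:E <= 1)%E.
Proof.
rewrite (integral_expR_shift _ _ (linear_mgf _)); last exact: measurable_dot_noise.
rewrite -expRD lee_fin dotvZl dotvC dotvZl (_ : _ + _ = 0) ?expR0//.
by field; rewrite gt_eqF.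
Qed.

Lemma gaussian_good_event (M : finType) (S : M -> {vspace 'rV[R]_n}) (v : M -> 'rV[R]_n)
    (r : R) : 0 < r ->
  exists A : set Omega, [/\ measurable A,
    ((1 - 4 * #|M|%:R * expR (- (n%:R * r ^+ 2)))%R%:E <= P A)%E &
    forall w, A w -> forall m,
      [/\ 2 * dotv (v m) (e w) <= dotv (v m) (v m) + 2 * n%:R * r ^+ 2 * sigma ^+ 2,
          - (2 * dotv (v m) (e w)) <= dotv (v m) (v m) + 2 * n%:R * r ^+ 2 * sigma ^+ 2,
          sqr_proj (S m) w <=
            sigma ^+ 2 * ((\dim (S m))%:R + 2 * n%:R * r + 4 * n%:R * r ^+ 2) &
          sigma ^+ 2 * ((\dim (S m))%:R - 2 * n%:R * r) <= sqr_proj (S m) w]].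
Proof.
move=> r0.
(* The four deviations of each model, each normalized so that its exponential
   has expectation at most 1 and that it fails when it exceeds [n r^2]. *)
pose G (i : M * 'I_4) (w : Omega) : R := let V := S i.1 in
  match nat_of_ord i.2 with
  | 0%N => dotv (sigma ^- 2 *: v i.1) (e w) +
           - (dotv (v i.1) (v i.1) / (2 * sigma ^+ 2))
  | 1%N => dotv (sigma ^- 2 *: - v i.1) (e w) +
           - (dotv (- v i.1) (- v i.1) / (2 * sigma ^+ 2))
  | 2%N => r / (1 + 2 * r) / sigma ^+ 2 * sqr_proj V w +
     (n%:R * r ^+ 2 - r / (1 + 2 * r) *
        ((\dim V)%:R + 2 * n%:R * r + 4 * n%:R * r ^+ 2))
  | _ => - (r / sigma ^+ 2 * sqr_proj V w) +
     (r * ((\dim V)%:R - 2 * n%:R * r) + n%:R * r ^+ 2)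
  end.
have mG i : measurable_fun setT (G i).
  have mD := measurable_dot_noise eps; have mQ := measurable_sqr_proj (S i.1).
  rewrite /G; case: (nat_of_ord i.2) => [|[|[|k]]]; apply: measurable_funD => //.
    exact: measurable_funM.
  by apply: measurableT_comp => //; exact: measurable_funM.
have G1 i : (\int[P]_w (expR (G i w))%:E <= 1)%E.
  rewrite /G; case: (nat_of_ord i.2) => [|[|[|k]]]; [exact: linear_upper..| |].
    by apply: chi2_upper; exact: ltW.
  by apply: chi2_lower; exact: ltW.
have [A [mA PA GA]] := chernoff_union (n%:R * r ^+ 2) mG G1.
exists A; split=> //; first by move: PA; rewrite card_prod card_ord natrM [_ * 4]mulrC.
move=> w Aw m; have u0 : 0 < 1 + 2 * r by lra.
have s2 : 0 < sigma ^+ 2 by rewrite exprn_gt0.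
have lin (b q X : R) : sigma ^- 2 * q - b / (2 * sigma ^+ 2) <= X ->
    2 * q <= b + 2 * X * sigma ^+ 2.
  rewrite (_ : _ - _ = (2 * q - b) / (2 * sigma ^+ 2)); last first.
    by field; rewrite gt_eqF.
  by rewrite ler_pdivrMr ?mulr_gt0//; lra.
split.
- have := GA w Aw (m, inord 0); rewrite /G/= inordK//= dotvZl => /lin.
  by rewrite mulrA.
- have := GA w Aw (m, inord 1); rewrite /G/= inordK//= dotvZl => /lin.
  by rewrite !dotvNl [dotv _ (- _)]dotvC dotvNl opprK mulrN mulrA.
- have := GA w Aw (m, inord 2); rewrite /G/= inordK//= addrCA gerDl subr_le0.
  set k := r / (1 + 2 * r); have k0 : 0 < k by rewrite divr_gt0.
  by rewrite -mulrA ler_pM2l// [_^-1 * _]mulrC ler_pdivrMr// [_ * sigma ^+ 2]mulrC.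
- have := GA w Aw (m, inord 3); rewrite /G/= inordK//= addrA gerDr addrC subr_le0.
  by rewrite -[r / _ * _]mulrA ler_pM2l// [_^-1 * _]mulrC ler_pdivlMr// [_ * sigma ^+ 2]mulrC.
Qed.

End GoodEvent.

(** * Model selection on the good event *)

Section Bias.
Variables (R : realType) (n : nat) (M : finType) (S : M -> {vspace 'rV[R]_n}).

(** There are finitely many models, so the infimum is a minimum. *)
Lemma bias_attained (F : 'rV[R]_n) (c : R) : (exists m, model_dim S m <= c) ->
  exists2 m, model_dim S m <= c &
    bias S F c = n%:R^-1 * enorm (F - orthproj (S m) F) ^+ 2.
Proof.
move=> [m0 cm0].
pose f m := n%:R^-1 * enorm (F - orthproj (S m) F) ^+ 2.
have [m cm fm] := @arg_minP _ _ _ m0 (fun m => model_dim S m <= c) f cm0.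
exists m => //; apply/eqP; rewrite eq_le; apply/andP; split.
  apply: ge_inf; last by exists m.
  by exists (f m) => _ [m' cm' <-]; exact: fm.
apply: lb_le_inf; first by exists (f m); exists m.
by move=> _ [m' cm' <-]; exact: fm.
Qed.

End Bias.

Section Deterministic.
Variables (R : realType) (n : nat) (M : finType) (S : M -> {vspace 'rV[R]_n}).
Variables (F e : 'rV[R]_n) (sigma x : R) (mh : R -> M).
Hypotheses (n0 : (0 < n)%N) (sigma0 : 0 < sigma) (x0 : 0 <= x).
Hypothesis mhP : forall C, 0 <= C -> argmin setT (penalized_risk S (F + e) C) (mh C).
Let v m := F - orthproj (S m) F.
Let Q m := dotv (orthproj (S m) e) (orthproj (S m) e).
Let r := Num.sqrt (x / n%:R).
Hypothesis good : forall m,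
  [/\ 2 * dotv (v m) e <= dotv (v m) (v m) + 2 * n%:R * r ^+ 2 * sigma ^+ 2,
      - (2 * dotv (v m) e) <= dotv (v m) (v m) + 2 * n%:R * r ^+ 2 * sigma ^+ 2,
      Q m <= sigma ^+ 2 * ((\dim (S m))%:R + 2 * n%:R * r + 4 * n%:R * r ^+ 2) &
      sigma ^+ 2 * ((\dim (S m))%:R - 2 * n%:R * r) <= Q m].

Let nR0 : 0 < n%:R :> R. Proof. by rewrite ltr0n. Qed.
Let s20 : 0 < sigma ^+ 2. Proof. by rewrite exprn_gt0. Qed.
Let r0 : 0 <= r. Proof. exact: sqrtr_ge0. Qed.
Let r2 : r ^+ 2 = x / n%:R.
Proof. by rewrite sqr_sqrtr// divr_ge0 ?ler0n. Qed.

Let C1E T : C1 n sigma x T = sigma ^+ 2 * (1 - (4 * r + 6 * r ^+ 2) / (1 - T / n%:R)).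
Proof. by rewrite /C1 -/r r2 [6 * (x / _)]mulrA. Qed.

Let C2E T c : c < T ->
  C2 S F sigma x T c = sigma ^+ 2 +
   (sigma ^+ 2 * (4 * n%:R * r + 8 * n%:R * r ^+ 2) + 2 * n%:R * bias S F c) / (T - c).
Proof.
move=> cT; rewrite /C2 -/r -[2 * x / _]mulrA -r2; field.
by rewrite subr_eq0 gt_eqF.
Qed.

(** The cross term [<v m, Pi_m e>] vanishes. *)
Let riskE C m : n%:R * penalized_risk S (F + e) C m =
  dotv (v m) (v m) + 2 * dotv (v m) e + dotv e e - Q m + C * (\dim (S m))%:R.
Proof.
have [pFS pF] := orthprojP (S m) F; have [peS pe] := orthprojP (S m) e.
rewrite /penalized_risk enorm_sqr linearD/=.
have -> : orthproj (S m) F + orthproj (S m) e - (F + e) =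
    - (v m + (e - orthproj (S m) e)).
  by rewrite /v [RHS]opprD !opprB opprD addrACA.
rewrite dotvNl dotvC dotvNl opprK dotvv_sqrD sqr_dist_orthproj.
have -> : dotv (v m) (e - orthproj (S m) e) = dotv (v m) e.
  by rewrite dotvC dotvBl [X in _ - X]dotvC pF// subr0 dotvC.
by rewrite /model_dim -/(Q m); field; rewrite gt_eqF.
Qed.

Let risk_le C m : 0 <= C ->
  n%:R * penalized_risk S (F + e) C (mh C) <= n%:R * penalized_risk S (F + e) C m.
Proof. by move=> /mhP[_ mhC]; rewrite ler_pM2l//; exact: mhC. Qed.

(** The full model [m1] has penalized risk [C]. A model of dimension [D <= T]
    has a penalized risk at least
    [sigma^2 (1 - D / n - 4 r - 6 r^2) + C D / n], which is larger. *)
Lemma dim_gt_of_lt_C1 m1 C T : S m1 = fullv -> T < n%:R -> 0 <= C ->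
  C < C1 n sigma x T -> T < model_dim S (mh C).
Proof.
move=> Sm1 Tn C0; rewrite C1E => CC1; rewrite ltNge; apply/negP => DT.
have := risk_le m1 C0; rewrite !riskE.
have pf u : orthproj (S m1) u = u.
  by apply: orthprojU => [|w _]; rewrite ?Sm1 ?memvf// subrr dotv0l.
have Qm1 : Q m1 = dotv e e by rewrite /Q pf.
have vm1 : v m1 = 0 by rewrite /v pf subrr.
have dm1 : (\dim (S m1))%:R = n%:R :> R by rewrite Sm1 dimvf /dim/= mul1n.
have [_ _ _] := good m1; rewrite Qm1 vm1 !dotv0l mulr0 !add0r subrr add0r dm1 => le1.
have [_ gm2 gm3 _] := good (mh C); move: DT; rewrite /model_dim.
move: gm2 gm3; set D := (\dim _)%:R; set a := dotv _ _; set b := dotv _ _.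
move=> gm2 gm3 DT le2.
have D1 : 0 < 1 - T / n%:R by rewrite subr_gt0 ltr_pdivrMr// mul1r.
have nD : 0 < n%:R - D by rewrite subr_gt0 (le_lt_trans DT).
have : sigma ^+ 2 * (n%:R - D - n%:R * (4 * r + 6 * r ^+ 2)) <= C * (n%:R - D).
  lra.
have D1E : 1 - T / n%:R = (n%:R - T) / n%:R by field; rewrite gt_eqF.
have nT : 0 < n%:R - T by rewrite subr_gt0.
set k := 4 * r + 6 * r ^+ 2.
have k0 : 0 <= k by rewrite addr_ge0 ?mulr_ge0 ?exprn_ge0.
apply/negP; rewrite -ltNge; move: CC1; rewrite -(ltr_pM2r nD) => /lt_le_trans; apply.
rewrite -mulrA ler_pM2l// mulrBl mul1r lerD2l lerN2 D1E -/k invfM invrK.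
rewrite [n%:R * k]mulrC -!mulrA ler_wpM2l// [_^-1 * _]mulrC -mulrA.
rewrite ler_peMr//.
by rewrite ler_pdivlMr// mul1r lerD2l lerN2.
Qed.

(** Against the model [m0] of least bias, a model of dimension [D > T] saves at
    most [sigma^2 (D - D0 + 4 n r + 8 n r^2) + 2 n B(c)] in [n] times the
    empirical risk, and pays [C (D - D0)] more; divide by [D - D0 >= T - c]. *)
Lemma dim_le_of_gt_C2 C T c : (exists m, model_dim S m <= c) -> c < T ->
  C2 S F sigma x T c < C -> 0 <= C -> model_dim S (mh C) <= T.
Proof.
move=> /(bias_attained F)[m0 D0c BE] cT; rewrite C2E// => CC2 C0.
rewrite leNgt; apply/negP => TD; have := risk_le m0 C0; rewrite !riskE.
have [gm1 _ _ gm4] := good m0; have [_ gm2 gm3 _] := good (mh C).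
have {}BE : n%:R * bias S F c = dotv (v m0) (v m0).
  by rewrite BE enorm_sqr mulrA divff ?mul1r// gt_eqF.
have BE' : 2 * n%:R * bias S F c = 2 * dotv (v m0) (v m0) by rewrite -mulrA BE.
rewrite BE' in CC2; move: gm1 gm2 gm3 gm4 D0c TD CC2; rewrite /model_dim.
set D := (\dim _)%:R; set D0 := (\dim _)%:R.
set a := dotv (v (mh C)) e; set b := dotv (v (mh C)) (v (mh C)).
set a0 := dotv (v m0) e; set b0 := dotv (v m0) (v m0).
set K := _ + 2 * b0 => gm1 gm2 gm3 gm4 D0c TD CC2 le2.
have Tc : 0 < T - c by rewrite subr_gt0.
have DD : T - c <= D - D0 by lra.
have DD0 : 0 < D - D0 by lra.
have K0 : 0 <= K.
  have k0 : 0 <= 4 * n%:R * r + 8 * n%:R * r ^+ 2.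
    by rewrite addr_ge0 ?mulr_ge0 ?exprn_ge0.
  have b00 : 0 <= b0 by exact: dotvv_ge0.
  by apply: addr_ge0; apply: mulr_ge0 => //; exact: ltW.
have le3 : C * (D - D0) <= sigma ^+ 2 * (D - D0) + K by rewrite /K; lra.
have : (sigma ^+ 2 + K / (T - c)) * (D - D0) < C * (D - D0) by rewrite ltr_pM2r.
apply/negP; rewrite -leNgt (le_trans le3)// mulrDl lerD2l -mulrA.
by rewrite ler_peMr// mulrC ler_pdivlMr// mul1r.
Qed.

Lemma C2_ge_var T c : (exists m, model_dim S m <= c) -> c < T ->
  sigma ^+ 2 <= C2 S F sigma x T c.
Proof.
move=> /(bias_attained F)[m0 _ BE] cT; rewrite C2E// lerDl.
have B0 : 0 <= bias S F c.
  by rewrite BE; apply: mulr_ge0; rewrite ?invr_ge0 ?sqr_ge0.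
have k0 : 0 <= 4 * n%:R * r + 8 * n%:R * r ^+ 2.
  by rewrite addr_ge0 ?mulr_ge0 ?exprn_ge0.
apply: divr_ge0; last by rewrite subr_ge0 ltW.
apply: addr_ge0; first by apply: mulr_ge0 => //; exact: ltW.
by rewrite !mulr_ge0.
Qed.

Lemma C_thr_bounds T c : (exists m, model_dim S m <= c) ->
  (exists m1, S m1 = fullv) -> c < T -> T < n%:R ->
  C1 n sigma x T <= C_thr S mh T <= C2 S F sigma x T c.
Proof.
move=> cS [m1 Sm1] cT Tn.
have C20 : 0 <= C2 S F sigma x T c by apply: le_trans (C2_ge_var cS cT); exact: ltW.
set D := [set C | 0 <= C /\ model_dim S (mh C) <= T].
have DC2 C : C2 S F sigma x T c < C -> D C.
  move=> CC2; have C0 : 0 <= C by rewrite (le_trans C20)// ltW.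
  by split=> //; exact: dim_le_of_gt_C2 CC2 C0.
apply/andP; split.
  apply: lb_le_inf; first by exists (C2 S F sigma x T c + 1); apply: DC2; rewrite ltrDl.
  move=> C [C0 DC]; rewrite leNgt; apply/negP => /(dim_gt_of_lt_C1 Sm1 Tn C0).
  by rewrite ltNge DC.
apply/ler_addgt0Pr => d d0; apply: ge_inf; first by exists 0 => C [].
by apply: DC2; rewrite ltrDl.
Qed.

(** For [r^2 <= 1 / 180], hence [r < 3 / 40], one has [12 r + 18 r^2 < 1]. *)
Lemma C1_gt0 : x <= n%:R / 180 -> 0 < C1 n sigma x (2 * n%:R / 3).
Proof.
move=> xn; rewrite C1E mulr_gt0//.
have -> : 1 - 2 * n%:R / 3 / n%:R = 3^-1 :> R by field; rewrite gt_eqF.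
have r180 : r ^+ 2 <= 180^-1.
  by rewrite r2 ler_pdivrMr// mulrC.
have r3 : r < 3 / 40.
  rewrite ltNge; apply/negP => r3.
  have : (3 / 40) ^+ 2 <= r ^+ 2 by rewrite lerXn2r ?nnegrE//; lra.
  by move=> /le_trans/(_ r180); lra.
by rewrite invrK; lra.
Qed.

(** The condition on [eta] says that [C2 / (1 + eta) < C1 (1 + eta)]. Between
    these numbers the jump is more than [2 n / 3 - n / 3]. Below
    [C1 / (1 + eta)] both dimensions lie between [2 n / 3] and [n], and above
    [C2 (1 + eta)] both lie between [0] and [n / 3]. *)
Lemma C_window_bounds eta c Cw : (exists m, model_dim S m <= c) ->
  (exists m1, S m1 = fullv) -> c < n%:R / 3 -> 0 < eta -> C_window S mh eta Cw ->
  Num.sqrt (C2 S F sigma x (n%:R / 3) c / C1 n sigma x (2 * n%:R / 3)) - 1 < eta ->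
  x <= n%:R / 180 ->
  C1 n sigma x (2 * n%:R / 3) / (1 + eta) <= Cw <=
    C2 S F sigma x (n%:R / 3) c * (1 + eta).
Proof.
move=> cS [m1 Sm1] cn eta0 [/= Cw0 Cwmax] etaC xn.
have C10 := C1_gt0 xn; have C2s := C2_ge_var cS cn.
have T2n : 2 * n%:R / 3 < n%:R :> R by have := nR0; lra.
move: etaC C10 C2s; set a := C1 _ _ _ _; set b := C2 _ _ _ _ _ _ => etaC a0 b_ge.
have b0 : 0 < b by exact: lt_le_trans b_ge.
have h0 : 0 < 1 + eta by lra.
have lowdim C : b < C -> model_dim S (mh C) <= n%:R / 3.
  by move=> bC; apply: (dim_le_of_gt_C2 cS cn bC); exact: ltW (lt_trans b0 bC).
have highdim C : 0 < C -> C < a -> 2 * n%:R / 3 < model_dim S (mh C).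
  by move=> C0 Ca; apply: (dim_gt_of_lt_C1 Sm1 T2n (ltW C0) Ca).
have ba : b / (1 + eta) < a * (1 + eta).
  have q0 : 0 < b / a by rewrite divr_gt0.
  have : Num.sqrt (b / a) < 1 + eta by lra.
  rewrite -(ltr_pXn2r (n := 2)) ?nnegrE ?sqrtr_ge0 ?(ltW h0)// sqr_sqrtr ?(ltW q0)//.
  by rewrite ltr_pdivrMr// => bah; rewrite ltr_pdivrMr// -mulrA -expr2 mulrC.
(* The midpoint of the interval has a large jump. *)
pose C := (b / (1 + eta) + a * (1 + eta)) / 2.
have C0 : 0 < C by apply: divr_gt0 => //; apply: addr_gt0; [exact: divr_gt0|exact: mulr_gt0].
have := Cwmax C C0; rewrite /dim_jump.
have : 2 * n%:R / 3 < model_dim S (mh (C / (1 + eta))).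
  by apply: highdim; [exact: divr_gt0|rewrite ltr_pdivrMr// (midf_lt ba)].
have : model_dim S (mh (C * (1 + eta))) <= n%:R / 3.
  by apply: lowdim; rewrite -ltr_pdivrMr// (midf_lt ba).
have dim0 m : 0 <= model_dim S m by rewrite /model_dim.
have dimn m : model_dim S m <= n%:R.
  rewrite ler_nat; exact: leq_trans (leq_addr _ _) (eq_leq (dim_orthocompl _)).
move=> lowC highC jump; apply/andP; split; rewrite leNgt; apply/negP => CwC.
  have := highdim (Cw * (1 + eta)); rewrite mulr_gt0// => /(_ isT).
  rewrite -ltr_pdivlMr// => /(_ CwC) highw.
  by have := dimn (mh (Cw / (1 + eta))); lra.
have := lowdim (Cw / (1 + eta)); rewrite ltr_pdivlMr// => /(_ CwC) loww.
by have := dim0 (mh (Cw * (1 + eta))); lra.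
Qed.

End Deterministic.

(** * Expectation bounds from geometric tails *)

Section LowerIntegral.
Context d (Omega : measurableType d) (R : realType) (P : probability Omega R).

Import HBNNSimple.

(** The integral of a nonnegative function is the supremum of the integrals of
    the simple functions below it, so monotonicity does not involve
    measurability. *)
Lemma ge0_le_lower_integral (f g : Omega -> \bar R) :
  (forall w, 0 <= f w)%E -> (forall w, f w <= g w)%E ->
  (\int[P]_w f w <= \int[P]_w g w)%E.
Proof.
move=> f0 fg; have g0 w : (0 <= g w)%E by exact: le_trans (f0 w) (fg w).
rewrite !ge0_integralTE//; apply: le_ereal_sup => _ [h hf <-]; exists h => //.
by move=> w; exact: le_trans (hf w) (fg w).
Qed.

(** The summand telescopes: it is [u_j - u_(j+1)] for
    [u_j = (A + B j) q^j]. *)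
Lemma geometric_affine_sum (q alpha beta : R) (k : nat) :
  0 <= q < 1 -> 0 <= alpha -> 0 <= beta ->
  \sum_(j < k) (alpha + beta * j%:R) * q ^+ j <=
  alpha / (1 - q) + beta * q / (1 - q) ^+ 2.
Proof.
move=> /andP[q0 q1] a0 b0; have q1' : 0 < 1 - q by rewrite subr_gt0.
set A := _ + _; pose B := beta / (1 - q).
have A0 : 0 <= A by rewrite addr_ge0 ?divr_ge0 ?mulr_ge0 ?sqr_ge0 ?(ltW q1').
have B0 : 0 <= B by rewrite divr_ge0 ?(ltW q1').
have -> : \sum_(j < k) (alpha + beta * j%:R) * q ^+ j = A - (A + B * k%:R) * q ^+ k.
  elim: k => [|k IH]; first by rewrite big_ord0 mulr0 addr0 mulr1 subrr.
  rewrite big_ord_recr/= IH exprS -natr1 /A /B; field.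
  by rewrite gt_eqF.
by rewrite gerBl mulr_ge0 ?exprn_ge0// addr_ge0// mulr_ge0.
Qed.

(** Let [N j] be the event that the first [j + 1] good events all fail.
    Pointwise [f <= h 0 + \sum_j (h (j + 1) - h j) 1_(N j)]: if [A k] is the first good
    event that holds, the sum is at least [h k - h 0]; if none holds, the sum is
    infinite since the increments are at least [alpha > 0]. *)
Lemma integral_le_geometric_tails (f : Omega -> R) (h : nat -> R)
    (q alpha beta : R) :
  (forall w, 0 <= f w) -> 0 <= q < 1 -> 0 < alpha -> 0 <= beta -> 0 <= h 0 ->
  (forall k, h k.+1 = h k + (alpha + beta * k%:R)) ->
  (forall k, exists A : set Omega, [/\ measurable A, ((1 - q ^+ k)%:E <= P A)%E &
    forall w, A w -> f w <= h k]) ->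
  (\int[P]_w (f w)%:E <=
    (h 0 + (alpha / (1 - q) + beta * q / (1 - q) ^+ 2))%:E)%E.
Proof.
move=> f0 q01 alpha0 beta0 h0 hS /choice[A AP].
have mA k : measurable (A k) by have [] := AP k.
pose N k := \bigcap_(j in [set j | (j <= k)%N]) ~` A j.
have mN k : measurable (N k).
  by apply: bigcap_measurableType => j _; exact: measurableC.
pose a k := alpha + beta * k%:R.
have a0 k : 0 <= a k by rewrite addr_ge0 ?(ltW alpha0)// mulr_ge0.
have PN k : (P (N k) <= (q ^+ k)%:E)%E.
  have [_ PA _] := AP k.
  apply: (@le_trans _ _ (P (~` A k))).
    apply: le_measure; rewrite ?inE//; first exact: measurableC.
    by move=> w; apply => /=.
  rewrite probability_setC//; move: PA.
  by rewrite -(fineK (fin_num_measure P _ (mA k))) !lee_fin; lra.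
pose t k w : \bar R := (a k * \1_(N k) w)%:E.
have t0 k w : (0 <= t k w)%E by rewrite lee_fin mulr_ge0.
have mt k : measurable_fun setT (t k).
  by apply/measurable_EFinP; apply: measurable_funM => //; exact: measurable_indic.
have hE k : h k = h 0 + \sum_(j < k) a j.
  elim: k => [|k IH]; first by rewrite big_ord0 addr0.
  by rewrite hS IH big_ord_recr/= -addrA.
apply: (@le_trans _ _ (\int[P]_w ((h 0)%:E + \sum_(k <oo) t k w))%E).
  apply: ge0_le_lower_integral => w; first by rewrite lee_fin.
  have [k Nk fk] : exists2 k, (forall j, (j < k)%N -> N j w) & f w <= h k.
    have [[k Ak]|noA] := pselect (exists k, A k w).
      have exA : exists k, `[< A k w >] by exists k; apply/asboolP.
      case: (ex_minnP exA) => m /asboolP Am mmin; exists m.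
        move=> j jm i /= ij /asboolP/mmin; rewrite leqNgt.
        by rewrite (leq_ltn_trans ij jm).
      by have [_ _] := AP m; exact.
    have [k fk] : exists k : nat, f w / alpha <= k%:R.
      exists (Num.bound (f w / alpha)); apply/ltW/archi_boundP.
      by rewrite divr_ge0 ?(ltW alpha0).
    exists k; first by move=> j _ i _ /= Ai; apply: noA; exists i.
    rewrite ler_pdivrMr// in fk; apply: le_trans fk _; rewrite hE.
    rewrite ler_wpDl//; apply: (@le_trans _ _ (\sum_(j < k) alpha)).
      by rewrite sumr_const card_ord mulr_natl.
    by apply: ler_sum => j _; rewrite lerDl mulr_ge0.
  apply: (@le_trans _ _ (h k)%:E); first by rewrite lee_fin.
  rewrite hE EFinD leeD2l//.
  apply: le_trans (nneseries_lim_ge k _) => //.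
  rewrite -sumEFin big_mkord; apply: lee_sum => j _.
  rewrite /t /indic mem_set ?mulr1//; exact: Nk.
rewrite ge0_integralD//; last 2 first.
- by move=> w _; apply: nneseries_ge0 => k _ _; exact: t0.
- exact: ge0_emeasurable_sum.
rewrite integral_cst//= probability_setT mule1 EFinD leeD2l//.
rewrite integral_nneseries//.
apply: lime_le.
  by apply: is_cvg_nneseries => k _ _; apply: integral_ge0.
apply: nearW => k; rewrite big_mkord.
apply: (@le_trans _ _ (\sum_(j < k) (a j * q ^+ j)%:E)%E).
  apply: lee_sum => j _; rewrite /t.
  under eq_integral do rewrite EFinM.
  rewrite ge0_integralZl//.
  - rewrite integral_indic// setIT EFinM; apply: lee_wpmul2l; last exact: PN.
    by rewrite lee_fin.
  - by apply/measurable_EFinP; exact: measurable_indic.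
  - by rewrite lee_fin.
by rewrite sumEFin lee_fin; apply: geometric_affine_sum => //; exact: ltW.
Qed.

End LowerIntegral.

(** * Risk of the threshold estimator *)

Section SquaredError.
Variable R : realFieldType.

(** The constants come from [(p + q + b)^2 <= (5/4) q^2 + 10 p^2 + 10 b^2] with
    [p = 4 s t], [q = 8 s t^2] and [2 b] for [b]. *)
Lemma sqr_error_le (s t b K1 K2 z : R) : 0 <= s -> 0 <= t -> 0 <= b ->
  - (K1 * (s * (4 * t + 6 * t ^+ 2))) <= z ->
  z <= K2 * (s * (4 * t + 8 * t ^+ 2) + 2 * b) -> 0 <= K1 -> 0 <= K2 ->
  z ^+ 2 <= Num.max (K1 ^+ 2) (K2 ^+ 2) *
    (80 * s ^+ 2 * t ^+ 4 + 160 * s ^+ 2 * t ^+ 2 + 40 * b ^+ 2).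
Proof.
move=> s0 t0 b0 zlo zhi K10 K20.
pose u := s * (4 * t + 8 * t ^+ 2) + 2 * b.
have u'0 : 0 <= s * (4 * t + 6 * t ^+ 2).
  by rewrite mulr_ge0// addr_ge0 ?mulr_ge0 ?exprn_ge0.
have u'u : s * (4 * t + 6 * t ^+ 2) <= u.
  rewrite -subr_ge0 (_ : _ - _ = s * (2 * t ^+ 2) + 2 * b); last by rewrite /u; ring.
  by rewrite addr_ge0 ?mulr_ge0 ?exprn_ge0.
have u0 : 0 <= u by exact: le_trans u'u.
have uu : u ^+ 2 <= 80 * s ^+ 2 * t ^+ 4 + 160 * s ^+ 2 * t ^+ 2 + 40 * b ^+ 2.
  rewrite -subr_ge0 (_ : _ - _ = (4 * s * t ^+ 2 - 2 * (4 * s * t + 2 * b)) ^+ 2 +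
    5 * (4 * s * t - 2 * b) ^+ 2); last by rewrite /u; ring.
  by rewrite addr_ge0 ?sqr_ge0// mulr_ge0 ?sqr_ge0.
suff : z ^+ 2 <= Num.max (K1 ^+ 2) (K2 ^+ 2) * u ^+ 2.
  move=> /le_trans; apply; apply: ler_wpM2l uu.
  by rewrite le_max sqr_ge0.
have [z0|z0] := leP 0 z.
  apply: (@le_trans _ _ (K2 ^+ 2 * u ^+ 2)).
    by rewrite -exprMn lerXn2r ?nnegrE// mulr_ge0.
  by apply: ler_wpM2r; rewrite ?sqr_ge0 ?le_max ?lexx ?orbT.
apply: (@le_trans _ _ (K1 ^+ 2 * u ^+ 2)).
  rewrite -sqrrN -exprMn lerXn2r ?nnegrE ?mulr_ge0 ?oppr_ge0 ?(ltW z0)//.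
  by rewrite lerNl; apply: le_trans zlo; rewrite lerN2 ler_wpM2l.
by apply: ler_wpM2r; rewrite ?sqr_ge0 ?le_max ?lexx ?orbT.
Qed.

End SquaredError.

Section NumericalConstants.
Variable R : realType.

Lemma expRN_nat_le (k : nat) : expR (- k%:R) <= (2 / 5) ^+ k :> R.
Proof.
have e1 : 5 / 2 <= expR 1 :> R.
  have e6 : (1 + 6^-1) ^+ 6 <= expR (6^-1 : R) ^+ 6.
    by rewrite lerXn2r ?nnegrE ?expR_ge0 ?expR_ge1Dx//; lra.
  by move: e6; rewrite -expRM_natr mulVf// => /(le_trans _); apply; lra.
rewrite -[k%:R]mulr1 mulrC -mulNr expRM_natr lerXn2r ?nnegrE ?expR_ge0//; last first.
  rewrite expRN -[_ / _]invrK lef_pV2 ?posrE ?expR_gt0 ?invr_gt0//; first by lra.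
Qed.

Lemma ln4_ge1 : 1 <= ln 4 :> R.
Proof.
have : ln (1 + - (1 / 2)) <= - (1 / 2) :> R by apply: le_ln1Dx; lra.
have -> : 1 + - (1 / 2) = 2^-1 :> R by field.
have -> : 4 = 2 ^+ 2 :> R by ring.
by rewrite lnV ?posrE// lnXn// -[ln 2 *+ 2]mulr_natr; lra.
Qed.

End NumericalConstants.

Section Proposition.
Context d (Omega : measurableType d) (R : realType) (P : probability Omega R).
Variables (n : nat) (F : 'rV[R]_n) (sigma : R) (eps : 'I_n -> {RV P >-> R}).
Variables (M : finType) (S : M -> {vspace 'rV[R]_n}).
Variable mhat : Omega -> R -> M.
Hypotheses (n0 : (0 < n)%N) (sigma0 : 0 < sigma) (gauss : gaussian_noise sigma eps).
Hypothesis mhatP : forall w C, 0 <= C ->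
  argmin setT (penalized_risk S (observation F eps w) C) (mhat w C).

(** The event depends on [x] only, not on [T], [c] or [eta]; the risk bound uses
    it with [c = T / 2]. *)
Lemma slope_event (x : R) : 0 < x ->
  exists A : set Omega, [/\ measurable A,
    ((1 - 4 * #|M|%:R * expR (- x))%R%:E <= P A)%E &
    forall w, A w -> forall T c, (exists m, model_dim S m <= c) ->
      (exists m1, S m1 = fullv) -> c < T -> T < n%:R ->
      C1 n sigma x T <= C_thr S (mhat w) T <= C2 S F sigma x T c /\
      forall eta Cw, c < n%:R / 3 -> 0 < eta -> C_window S (mhat w) eta Cw ->
        Num.sqrt (C2 S F sigma x (n%:R / 3) c / C1 n sigma x (2 * n%:R / 3)) - 1
          < eta -> x <= n%:R / 180 ->
        C1 n sigma x (2 * n%:R / 3) / (1 + eta) <= Cw <=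
          C2 S F sigma x (n%:R / 3) c * (1 + eta)].
Proof.
move=> x0; have nR : 0 < n%:R :> R by rewrite ltr0n.
have r0 : 0 < Num.sqrt (x / n%:R) by rewrite sqrtr_gt0 divr_gt0.
have nr2 : n%:R * Num.sqrt (x / n%:R) ^+ 2 = x.
  by rewrite sqr_sqrtr ?divr_ge0 ?(ltW x0)// mulrC divfK// gt_eqF.
have [A [mA PA good]] :=
  gaussian_good_event sigma0 gauss S (fun m => F - orthproj (S m) F) r0.
exists A; split=> //; first by rewrite -[X in expR (- X)]nr2.
move=> w Aw T c cS fS cT Tn; split.
  exact: (C_thr_bounds n0 sigma0 (ltW x0) (mhatP w) (good w Aw) cS fS cT Tn).
move=> eta Cw cn eta0 Cwmax etaC xn.
exact: (C_window_bounds n0 sigma0 (ltW x0) (mhatP w) (good w Aw) cS fS cn eta0 Cwmax etaC xn).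
Qed.

(** The squared error is at most [h k] on the event of [slope_event] for
    [x = L + k]. The resulting series is at most the stated bound because
    [L >= 1], which absorbs the terms of lower degree in [L]. *)
Lemma expectation_C_thr T : (exists m, model_dim S m <= T / 2) ->
  (exists m1, S m1 = fullv) -> 0 < T -> T < n%:R ->
  (\int[P]_w ((C_thr S (mhat w) T - sigma ^+ 2) ^+ 2)%:E <=
    (739 * Num.max ((1 - T / n%:R) ^- 2) ((T / (2 * n%:R)) ^- 2) *
     (bias S F (T / 2) ^+ 2 +
      sigma ^+ 4 * ln (4 * #|M|%:R) / n%:R +
      sigma ^+ 4 * (ln (4 * #|M|%:R) / n%:R) ^+ 2))%R%:E)%E.
Proof.
move=> Tm fS T0 Tn; have nR : 0 < n%:R :> R by rewrite ltr0n.
have M0 : (0 < #|M|)%N by case: fS => m1 _; apply/card_gt0P; exists m1.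
set L := ln (4 * #|M|%:R); set B := bias S F (T / 2).
have L1 : 1 <= L.
  apply: le_trans (@ln4_ge1 R) _; rewrite ler_ln ?posrE ?mulr_gt0 ?ltr0n//.
  by rewrite ler_peMr// ler1n.
have expL : expR L = 4 * #|M|%:R by rewrite lnK ?posrE ?mulr_gt0 ?ltr0n.
have B0 : 0 <= B.
  have [m _ BE] := bias_attained F Tm; rewrite /B BE.
  by apply: mulr_ge0; rewrite ?invr_ge0 ?sqr_ge0.
set K := Num.max _ _.
have aT : 0 < 1 - T / n%:R by rewrite subr_gt0 ltr_pdivrMr// mul1r.
have bT : 0 < T / (2 * n%:R) by rewrite divr_gt0 ?mulr_gt0.
have K0 : 0 < K by rewrite lt_max invr_gt0 exprn_gt0.
pose h (k : nat) := K * (80 * sigma ^+ 4 * ((L + k%:R) / n%:R) ^+ 2 +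
   160 * sigma ^+ 4 * ((L + k%:R) / n%:R) + 40 * B ^+ 2).
pose alpha := K * sigma ^+ 4 * (80 * (2 * L + 1) / n%:R ^+ 2 + 160 / n%:R).
pose beta := K * sigma ^+ 4 * (160 / n%:R ^+ 2).
have s40 : 0 < sigma ^+ 4 by rewrite exprn_gt0.
have hS k : h k.+1 = h k + (alpha + beta * k%:R).
  by rewrite /h /alpha /beta -natr1; field; rewrite gt_eqF.
have alpha0 : 0 < alpha.
  apply: mulr_gt0; first exact: mulr_gt0.
  by apply: addr_gt0; apply: divr_gt0 => //; [lra | rewrite exprn_gt0].
have beta0 : 0 <= beta.
  by apply: mulr_ge0; [apply: mulr_ge0; exact: ltW|rewrite divr_ge0 ?exprn_ge0].
have h0 : 0 <= h 0.
  apply: mulr_ge0; first exact: ltW.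
  have y0 : 0 <= (L + 0) / n%:R by rewrite addr0 divr_ge0//; lra.
  apply: addr_ge0; last by rewrite mulr_ge0 ?sqr_ge0.
  by apply: addr_ge0; apply: mulr_ge0; rewrite ?sqr_ge0// mulr_ge0// ltW.
(* [L] is chosen so that [4 card M exp (- (L + k)) = exp (- k)]. *)
have tails k : exists A : set Omega, [/\ measurable A,
    ((1 - (2 / 5) ^+ k)%:E <= P A)%E &
    forall w, A w -> (C_thr S (mhat w) T - sigma ^+ 2) ^+ 2 <= h k].
  have x0 : 0 < L + k%:R by rewrite ltr_wpDr// (lt_le_trans ltr01).
  have [A [mA PA good]] := slope_event x0; exists A; split=> //.
    apply: le_trans PA; rewrite lee_fin lerD2l lerN2 -expL -expRD opprD addrA.
    by rewrite subrr add0r expRN_nat_le.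
  move=> w Aw; have T2 : T / 2 < T by lra.
  have [/andP[lo hi] _] := good w Aw T (T / 2) Tm fS T2 Tn.
  set t := Num.sqrt ((L + k%:R) / n%:R).
  have t2 : t ^+ 2 = (L + k%:R) / n%:R.
    by rewrite sqr_sqrtr// divr_ge0 ?(ltW x0).
  have s4 : sigma ^+ 4 = (sigma ^+ 2) ^+ 2 by rewrite -exprM.
  have t4 : (t ^+ 2) ^+ 2 = t ^+ 4 by rewrite -exprM.
  rewrite /h -t2 t4 s4 /K -!exprVn.
  apply: sqr_error_le.
  - exact: sqr_ge0.
  - exact: sqrtr_ge0.
  - exact: B0.
  - move: lo; rewrite /C1 -/t -[6 * _ / _]mulrA -t2; lra.
  - move: hi; rewrite /C2 -/t -/B -[2 * (L + _) / _]mulrA -t2 -(lerD2r (- sigma ^+ 2)).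
    move=> /le_trans; apply; rewrite le_eqVlt; apply/orP; left; apply/eqP.
    by field; rewrite !gt_eqF.
  - by rewrite invr_ge0 ltW.
  - by rewrite invr_ge0 ltW.
apply: le_trans (integral_le_geometric_tails (h := h) (q := 2 / 5)
  (alpha := alpha) (beta := beta) _ _ alpha0 beta0 h0 hS tails) _.
- by move=> w; exact: sqr_ge0.
- by lra.
rewrite lee_fin.
rewrite (_ : _ + _ = K * (40 * B ^+ 2 + sigma ^+ 4 * L / n%:R * 160 +
   sigma ^+ 4 / n%:R * (800 / 3) +
   sigma ^+ 4 / n%:R ^+ 2 * (80 * L ^+ 2 + 400 / 3 * (2 * L + 1) + 1600 / 9))); last first.
  by rewrite /h /alpha /beta; field; rewrite gt_eqF.
rewrite [739 * K]mulrC -[K * 739 * _]mulrA ler_pM2l// -subr_ge0.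
rewrite (_ : _ - _ = 699 * B ^+ 2 + sigma ^+ 4 / n%:R * (579 * L - 800 / 3) +
   sigma ^+ 4 / n%:R ^+ 2 *
     (659 * L ^+ 2 - 400 / 3 * (2 * L + 1) - 1600 / 9)); last first.
  by field; rewrite gt_eqF.
have L2 : L <= L ^+ 2 by rewrite expr2 ler_peMr//; lra.
apply: addr_ge0; [apply: addr_ge0|].
- by apply: mulr_ge0; [exact: ler0n|exact: sqr_ge0].
- by apply: mulr_ge0; [apply: divr_ge0; exact: ltW|lra].
- by apply: mulr_ge0; [apply: divr_ge0; rewrite ?exprn_ge0//; exact: ltW|lra].
Qed.

End Proposition.

(** * Minimal penalties *)

Theorem proposition3 (R : realType) (d : measure_display)
    (Omega : measurableType d) (P : probability Omega R)
    (n : nat) (F : 'rV[R]_n) (sigma : R) (eps : 'I_n -> {RV P >-> R})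
    (M : finType) (S : M -> {vspace 'rV[R]_n})
    (c T eta : R) (mhat : Omega -> R -> M) (Cwindow : Omega -> R) :
  0 < sigma ->
  gaussian_noise sigma eps ->
  0 <= c -> c < n%:R / 3 ->
  (exists m0 : M, model_dim S m0 <= c) ->
  (exists m1 : M, S m1 = fullv) ->
  c < T -> T < n%:R ->
  0 < eta ->
  (forall (w : Omega) (C : R), 0 <= C ->
     argmin setT (penalized_risk S (observation F eps w) C) (mhat w C)) ->
  (forall w : Omega, C_window S (mhat w) eta (Cwindow w)) ->
  (forall x : R, 0 <= x ->
     exists A : set Omega,
       [/\ measurable A,
           ((1 - 4 * #|M|%:R * expR (- x))%R%:E <= P A)%E
         & forall w : Omega, A w ->
             (eta > Num.sqrt (C2 S F sigma x (n%:R / 3) c /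
                              C1 n sigma x (2 * n%:R / 3)) - 1 ->
              x <= n%:R / 180 ->
              C1 n sigma x (2 * n%:R / 3) / (1 + eta) <= Cwindow w <=
                C2 S F sigma x (n%:R / 3) c * (1 + eta)) /\
             C1 n sigma x T <= C_thr S (mhat w) T <= C2 S F sigma x T c]) /\
  (c <= T / 2 ->
   ('E_P[(fun w : Omega => (C_thr S (mhat w) T - sigma ^+ 2) ^+ 2)%R] <=
    (739 * Num.max ((1 - T / n%:R) ^- 2) ((T / (2 * n%:R)) ^- 2) *
     (bias S F (T / 2) ^+ 2 +
      sigma ^+ 4 * ln (4 * #|M|%:R) / n%:R +
      sigma ^+ 4 * (ln (4 * #|M|%:R) / n%:R) ^+ 2))%R%:E)%E).
Proof.
move=> sigma0 gauss c0 cn3 cS fS cT Tn eta0 mhatP CwP.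
have n0 : (0 < n)%N by rewrite -(ltr_nat R); lra.
split=> [x x0|cT2]; last first.
  rewrite unlock; apply: (expectation_C_thr n0 sigma0 gauss mhatP _ fS _ Tn); last by lra.
  by case: cS => m cm; exists m; exact: le_trans cm cT2.
have [x_gt0|x_le0] := ltP 0 x.
  have [A [mA PA good]] := slope_event n0 sigma0 gauss mhatP x_gt0.
  exists A; split=> // w Aw; have [thr win] := good w Aw T c cS fS cT Tn.
  by split=> // etaC xn; exact: (win eta (Cwindow w) cn3 eta0 (CwP w) etaC xn).
(* For [x = 0] the required probability [1 - 4 card M] is negative. *)
exists set0; split=> //; rewrite measure0 lee_fin.
have -> : x = 0 by apply/eqP; rewrite eq_le x_le0.
have [m1 _] := fS; have M0 : (0 < #|M|)%N by apply/card_gt0P; exists m1.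
have : 1 <= #|M|%:R :> R by rewrite ler1n.
by rewrite oppr0 expR0; lra.
Qed.
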